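(* For every $K\in\mathbb R$, $N\in[1,\infty)$ and $D\in(0,\infty)$ there exists $\varepsilon=\varepsilon(K,N,D)>0$ such that for every $\mathsf{RCD}(K,N)$ space $(X,\mathsf d,\mathfrak m)$ with $\mathrm{diam}(X)\le D$, $$\lambda_1\ \ge\ \frac14\,h(X)^2+\varepsilon,$$ where $h(X)$ is the Cheeger constant of $X$ and $\lambda_1=\lambda_{1,2}(X)$.
   Context: A metric measure space $(X,\mathsf d,\mathfrak m)$ is a complete separable metric space with a $\sigma$-finite non-negative Borel measure $\mathfrak m$ such that $\operatorname{supp}\mathfrak m=X$ and, for some $x_0\in X$, $M>0$, $c\ge 0$, $\mathfrak m(B_r(x_0))\le M e^{cr^2}$ for all $r\ge 0$ (in particular $\mathfrak m(X)<\infty$ if $X$ is bounded). Slope: $\mathrm{lip}(f)(x)=\limsup_{y\to x}|f(y)-f(x)|/\mathsf d(x,y)$ ($=0$ at isolated points). $\mathsf{Lip}_{bs}(X)$: real Lipschitz functions with bounded support; $\mathsf{Lip}_{loc}(X)$: functions that are Lipschitz on bounded sets. $\mathcal P_2(X)$ is the space of probability measures with finite second moment, with Kantorovich–Wasserstein distance $W_2$. $\mathsf{Ent}_{\mathfrak m}(\mu)=\int\rho\log\rho\,d\mathfrak m$ if $\mu=\rho\mathfrak m$ with $(\rho\log\rho)^-\in L^1(X,\mathfrak m)$, and $+\infty$ otherwise; $D(\mathsf{Ent}_{\mathfrak m})=\{\mu\in\mathcal P_2(X):\mathsf{Ent}_{\mathfrak m}(\mu)\in\mathbb R\}$. The space is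 $\mathsf{CD}(K,\infty)$ if for all $\mu_0,\mu_1\in D(\mathsf{Ent}_{\mathfrak m})$ there is a $W_2$-geodesic $(\mu_t)_{t\in[0,1]}$ joining them with $\mathsf{Ent}_{\mathfrak m}(\mu_t)\le(1-t)\mathsf{Ent}_{\mathfrak m}(\mu_0)+t\,\mathsf{Ent}_{\mathfrak m}(\mu_1)-\frac K2 t(1-t)W_2^2(\mu_0,\mu_1)$ for all $t$. The Cheeger energy is $\mathsf{Ch}_{\mathfrak m,2}(f)=\inf\{\liminf_n\frac12\int_X\mathrm{lip}(f_n)^2d\mathfrak m: f_n\in\mathsf{Lip}_{bs}(X),\ f_n\to f\text{ in }L^2(X,\mathfrak m)\}$. The space is $\mathsf{RCD}(K,\infty)$ if it is $\mathsf{CD}(K,\infty)$ and $\mathsf{Ch}_{\mathfrak m,2}$ is a quadratic form. $\mathsf{RCD}(K,N)$, $N\in[1,\infty)$, is the subclass of $\mathsf{RCD}(K,\infty)$ spaces with synthetic dimension at most $N$, i.e. satisfying the $\mathsf{CD}(K,N)$ condition. For finite measures this is equivalent to the entropic condition: setting $U_N(\mu)=\exp(-\mathsf{Ent}_{\mathfrak m}(\mu)/N)$, for all $\mu_0,\mu_1\in D(\mathsf{Ent}_{\mathfrak m})$ there is a constant-speed $W_2$-geodesic $(\mu_t)$ joining them with $U_N(\mu_t)\ge\sigma^{(1-t)}_{K/N}(\theta)U_N(\mu_0)+\sigma^{(t)}_{K/N}(\theta)U_N(\mu_1)$, $\theta=W_2(\mu_0,\mu_1)$, $t\in[0,1]$,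 where $\sigma^{(t)}_\kappa(\theta)=\sin(\sqrt\kappa\,t\theta)/\sin(\sqrt\kappa\,\theta)$ if $0<\kappa\theta^2<\pi^2$, $=t$ if $\kappa\theta^2=0$, $=\sinh(\sqrt{-\kappa}\,t\theta)/\sinh(\sqrt{-\kappa}\,\theta)$ if $\kappa\theta^2<0$, $=+\infty$ if $\kappa\theta^2\ge\pi^2$. For $\mathfrak m(X)<\infty$: $\lambda_1=\inf\big\{\int_X\mathrm{lip}(f)^2d\mathfrak m\big/\int_X f^2d\mathfrak m:\ 0\not\equiv f\in\mathsf{Lip}_{bs}(X),\ \int_X f\,d\mathfrak m=0\big\}$. $\mathrm{Per}(A)=\inf\{\liminf_n\int_X\mathrm{lip}(f_n)\,d\mathfrak m: f_n\in\mathsf{Lip}_{loc}(X),\ f_n\to\chi_A\text{ in }L^1(X,\mathfrak m)\}$ for Borel $A$; $h(X)=\inf\{\mathrm{Per}(A)/\mathfrak m(A): A\subset X\text{ Borel},\ 0<\mathfrak m(A)\le\mathfrak m(X)/2\}$. Convention: $\inf\emptyset=+\infty$ (so for a one-point space the inequality reads $+\infty\ge+\infty$). *)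

(* Defs.v *)
From HB Require Import structures.
From mathcomp Require Import all_boot all_order all_algebra.
From mathcomp Require Import all_classical all_reals all_analysis.

Set Implicit Arguments.
Unset Strict Implicit.
Unset Printing Implicit Defensive.

Import Order.TTheory GRing.Theory Num.Theory.
Import numFieldNormedType.Exports.

Local Open Scope classical_set_scope.
Local Open Scope ring_scope.

(* Complete metric spaces. The base point inherited from completeType only
   says that the space is nonempty; it plays no role below. *)
#[short(type="completeMetricType")]
HB.structure Definition CompleteMetric (R : realType) :=
  {X of CompletePseudoMetric R X & PseudoMetric_isMetric R X}.

(* X with its Borel sigma-algebra; convertible to X. *)
Definition borel {R : realType} (X : completeMetricType R) :=
  g_sigma_algebraType (@open X).

Section MetricSpace.
Context {R : realType} {X : completeMetricType R}.
Implicit Types (A : set X) (f : X -> R).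

Definition metric_bounded A := exists (x : X) (r : R), A `<=` ball x r.

Definition metric_lipschitz A f :=
  exists L : R, forall x y, A x -> A y -> `|f x - f y| <= L * mdist x y.

Definition Lip_bs f :=
  metric_lipschitz setT f /\ metric_bounded (closure [set x | f x != 0]).

Definition Lip_loc f := forall A, metric_bounded A -> metric_lipschitz A f.

(* At an isolated point the punctured neighbourhood filter contains set0 and
   the limsup is -oo; the maximum turns it into 0 and is otherwise inert. *)
Definition slope f (x : X) : \bar R :=
  maxe 0%E (limf_esup (fun y => (`|f y - f x| / mdist x y)%:E) x^').

End MetricSpace.

Definition diameter {R : realType} (X : completeMetricType R) : \bar R :=
  ereal_sup [set (mdist z.1 z.2)%:E | z in [set: X * X]].

Section Wasserstein.
Context {R : realType} {X : completeMetricType R}.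
Implicit Types mu nu : probability (borel X) R.
Local Open Scope ereal_scope.

Definition P2 mu :=
  exists x0 : X, \int[mu]_x ((mdist (x : X) x0) ^+ 2)%:E < +oo.

Definition couplings mu nu : set (probability (borel X * borel X)%type R) :=
  [set p | forall A : set (borel X), measurable A ->
     p (A `*` setT) = mu A /\ p (setT `*` A) = nu A].

Definition W2 mu nu : \bar R :=
  sqrte (ereal_inf
    [set \int[p]_z ((mdist (z.1 : X) z.2) ^+ 2)%:E | p in couplings mu nu]).

Definition W2_geodesic mu nu (gamma : R -> probability (borel X) R) :=
  [/\ gamma 0%R = mu, gamma 1%R = nu,
      forall t, t \in `[0%R, 1%R] -> P2 (gamma t) &
      forall s t, s \in `[0%R, 1%R] -> t \in `[0%R, 1%R] ->
        W2 (gamma s) (gamma t) = `|s - t|%:E * W2 mu nu].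

End Wasserstein.

Section Spaces.
Context {R : realType} {X : completeMetricType R}.
Variable m : {measure set (borel X) -> \bar R}.
Implicit Types (mu : probability (borel X) R) (f g rho : X -> R).
Local Open Scope ereal_scope.

Definition msupport : set X :=
  [set x | forall U : set X, open_nbhs x U -> 0 < m U].

Definition metric_measure_space :=
  [/\ exists2 S : set X, countable S & dense S,
      sigma_finite setT m,
      msupport = setT &
      exists (x0 : X) (M c : R), [/\ (0 < M)%R, (0 <= c)%R &
        forall r : R, (0 <= r)%R ->
          m (ball x0 r) <= (M * expR (c * r ^+ 2))%:E]].

Definition density mu rho :=
  [/\ measurable_fun [set: borel X] rho, forall x, (0 <= rho x)%R &
      forall A : set (borel X), measurable A ->
        mu A = \int[m]_(x in A) (rho x)%:E].

(* The value does not depend on the density, which is unique m-a.e.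
   Note that ln 0 = 0 in the library, so that 0 log 0 = 0. *)
Definition Ent mu : \bar R :=
  xget +oo [set e | exists rho,
    [/\ density mu rho,
        \int[m]_x ((fun y => (rho y * ln (rho y))%:E)^\- x) < +oo &
        e = \int[m]_x (rho x * ln (rho x))%:E]].

Definition DEnt mu := P2 mu /\ Ent mu \is a fin_num.

Definition CD_infty (K : R) :=
  forall mu0 mu1, DEnt mu0 -> DEnt mu1 ->
    exists2 gamma, W2_geodesic mu0 mu1 gamma &
    forall t, t \in `[0%R, 1%R] ->
      Ent (gamma t) <= (1 - t)%:E * Ent mu0 + t%:E * Ent mu1
                       - (K / 2 * t * (1 - t))%:E * W2 mu0 mu1 ^+ 2.

Definition L2 f :=
  measurable_fun [set: borel X] f /\ \int[m]_x (f x ^+ 2)%:E < +oo.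

Definition cheeger_energy f : \bar R :=
  ereal_inf [set limn_einf
      (fun n => (2^-1)%:E * \int[m]_x (slope (F n) x ^+ 2)) |
    F in [set F : (X -> R)^nat | (forall n, Lip_bs (F n)) /\
      \int[m]_x ((F n x - f x) ^+ 2)%:E @[n --> \oo] --> 0]].

Definition quadratic_form_on_L2 (Q : (X -> R) -> \bar R) :=
  (forall (a : R) f, L2 f -> Q (fun x => a * f x)%R = (a ^+ 2)%:E * Q f) /\
  (forall f g, L2 f -> L2 g ->
    Q (fun x => f x + g x)%R + Q (fun x => f x - g x)%R =
    2%:E * Q f + 2%:E * Q g).

Definition RCD_infty (K : R) :=
  [/\ metric_measure_space, CD_infty K & quadratic_form_on_L2 cheeger_energy].

Definition U_ (N : R) mu : \bar R := expeR (- (N^-1%:E * Ent mu)).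

End Spaces.

Section RCD.
Context {R : realType}.

Definition sinh (x : R) : R := (expR x - expR (- x)) / 2.

(* distortion kappa t theta is the coefficient sigma_kappa^(t)(theta). *)
Definition distortion (kappa t theta : R) : \bar R :=
  let a := kappa * theta ^+ 2 in
  if pi ^+ 2 <= a then +oo%E
  else if 0 < a then
    (sin (Num.sqrt kappa * t * theta) / sin (Num.sqrt kappa * theta))%:E
  else if a == 0 then t%:E
  else (sinh (Num.sqrt (- kappa) * t * theta)
        / sinh (Num.sqrt (- kappa) * theta))%:E.

Context {X : completeMetricType R}.
Variable m : {measure set (borel X) -> \bar R}.
Local Open Scope ereal_scope.

Definition CD_entropic (K N : R) :=
  forall mu0 mu1 : probability (borel X) R, DEnt m mu0 -> DEnt m mu1 ->
    exists2 gamma, W2_geodesic mu0 mu1 gamma &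
    forall t, t \in `[0%R, 1%R] ->
      let theta := fine (W2 mu0 mu1) in
      distortion (K / N) (1 - t) theta * U_ m N mu0
      + distortion (K / N) t theta * U_ m N mu1 <= U_ m N (gamma t).

(* The dimension bound CD(K,N) is taken in its entropic form, which is
   equivalent to it, given RCD(K,oo), whenever m is finite. *)
Definition RCD (K N : R) := RCD_infty m K /\ CD_entropic K N.

Definition lambda1 : \bar R :=
  ereal_inf [set (\int[m]_x (slope f x ^+ 2)) / (\int[m]_x (f x ^+ 2)%:E) |
    f in [set f : X -> R | [/\ Lip_bs f, exists x, f x != 0%R &
                              \int[m]_x (f x)%:E = 0]]].

Definition perimeter (A : set X) : \bar R :=
  ereal_inf [set limn_einf (fun n => \int[m]_x slope (F n) x) |
    F in [set F : (X -> R)^nat | (forall n, Lip_loc (F n)) /\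
      \int[m]_x (`|F n x - \1_A x|%R)%:E @[n --> \oo] --> 0]].

Definition cheeger_constant : \bar R :=
  ereal_inf [set perimeter A / m A |
    A in [set A : set (borel X) |
      [/\ measurable A, 0 < m A & m A <= 2^-1%:E * m setT]]].

End RCD.

(* Main.v *)
Require Import Defs.
From HB Require Import structures.
From mathcomp Require Import all_boot all_order all_algebra.
From mathcomp Require Import all_classical all_reals all_analysis.
From mathcomp Require Import measurable_realfun.
From mathcomp Require Import ring lra.
Import Order.TTheory GRing.Theory Num.Theory.
Import numFieldNormedType.Exports.
Local Open Scope classical_set_scope.
Local Open Scope ring_scope.

(** The convexity of the entropy along geodesics and the diameter bound give an
    entropy-energy inequality for functions vanishing on half of the space; it
    excludes the only obstruction to improving Cheeger's argument.

    Let u >= 0 be Lipschitz, vanish on half of X, and have mean square 1; put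
    L = mean of |Du|^2, e = mean of u^2 ln u^2 >= 0 and H = h(X). Cheeger's
    argument integrates |Du|^2 >= 2 b |Du| - b^2 with b = (H/2) u, using the
    coarea inequality H int w <= int |Dw| (cheeger_L1). Adding to b the term
    a u 1_{u <= sigma} and optimising a gains a multiple of
    H^2 (sigma^2 m(u > sigma))^2 (level_gap). This gain is small at all levels
    sigma only if the mass of u^2 is spread over many scales of values of u, and
    then the entropy e is large. Quantitatively, averaging over the levels
    1, e, ..., e^(n-1), with n comparable to e + 1, gives
    L >= H^2/4 + c H^2 / (e + 1)^2 (averaged_gap, normalized_gap).

    It remains to bound (e + 1)^2 by C L (entropy_energy): then either H^2 is
    at least 2 L and the gain is at least a constant, or H^2/4 <= L/2 and
    L >= 1/C already suffices. The bound comes from the HWI inequality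
    Ent mu0 - Ent mu1 <= W2 sqrt(I(mu0)) + (kappa/2) W2^2, whose Fisher information
    I(mu0) is at most 4 L, for mu0 = u^2 m and mu1 the mixture
    (1 - s) mu0 + s m of it with the normalised uniform measure (mu0 is in fact
    slightly mixed too, so that its density is positive). Only the mass s moves,
    so W2^2 <= s D^2, whereas filling the half where u vanishes lowers the entropy
    by s ln (1/s) / 2 besides s e. For s small, depending on kappa D^2 only, the
    logarithm beats the defect of convexity, and s (e + 1) <= C' sqrt(s) D sqrt(L)
    remains. The HWI inequality itself is the comparison, to first order at mu0,
    of the convexity bound on the entropy with the duality bound
    Ent mu >= int ln(rho0) dmu, along a geodesic.

    A function of mean zero is finally cut at a median into two functions that
    vanish on half of the space (mean_zero_gap). *)

Set Implicit Arguments.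
Unset Strict Implicit.
Unset Printing Implicit Defensive.

(** * Bounded measurable functions *)

(** On a finite measure space these functions form an algebra on which the
    integral is real-valued and linear without further conditions. *)
Definition bmeas {d} {T : measurableType d} {R : realType} (f : T -> R) :=
  measurable_fun setT f /\ exists M, forall x, `|f x| <= M.

Section BoundedMeasurable.
Context {d} {T : measurableType d} {R : realType}.
Implicit Types f g : T -> R.

Lemma bmeas_cst (c : R) : bmeas (fun _ : T => c).
Proof. by split; [exact: measurable_cst|exists `|c|]. Qed.

Lemma bmeasD f g : bmeas f -> bmeas g -> bmeas (fun x => f x + g x).
Proof.
move=> [mf [M fM]] [mg [N gN]]; split; first exact: measurable_funD.
by exists (M + N) => x; rewrite (le_trans (ler_normD _ _))// lerD.
Qed.

Lemma bmeasM f g : bmeas f -> bmeas g -> bmeas (fun x => f x * g x).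
Proof.
move=> [mf [M fM]] [mg [N gN]]; split; first exact: measurable_funM.
by exists (M * N) => x; rewrite normrM ler_pM.
Qed.

Lemma bmeasZ (c : R) f : bmeas f -> bmeas (fun x => c * f x).
Proof. by move=> bf; apply: bmeasM => //; exact: bmeas_cst. Qed.

Lemma bmeasN f : bmeas f -> bmeas (fun x => - f x).
Proof.
by move=> /(bmeasZ (-1)); under eq_fun do rewrite mulN1r.
Qed.

Lemma bmeasB f g : bmeas f -> bmeas g -> bmeas (fun x => f x - g x).
Proof. by move=> bf bg; apply: bmeasD => //; exact: bmeasN. Qed.

Lemma bmeasX f n : bmeas f -> bmeas (fun x => f x ^+ n).
Proof.
move=> bf; elim: n => [|n ih]; first by under eq_fun do rewrite expr0; exact: bmeas_cst.
by under eq_fun do rewrite exprS; exact: bmeasM.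
Qed.

Lemma bmeas_indic (A : set T) : measurable A -> bmeas (\1_A : T -> R).
Proof.
move=> mA; split; first exact: measurable_indic.
by exists 1 => x; rewrite indicE; case: (_ \in _); rewrite ?normr0 ?normr1.
Qed.

Lemma bmeas_sum n (f : nat -> T -> R) : (forall k, bmeas (f k)) ->
  bmeas (fun x => \sum_(k < n) f k x).
Proof.
move=> bf; elim: n => [|n ih].
  by under eq_fun do rewrite big_ord0; exact: bmeas_cst.
by under eq_fun do rewrite big_ord_recr /=; exact: bmeasD.
Qed.

Context (mu : {finite_measure set T -> \bar R}).

Lemma bmeas_integrable f : bmeas f -> mu.-integrable setT (EFin \o f).
Proof.
move=> [mf [M fM]]; apply: measurable_bounded_integrable => //.
  exact: fin_num_fun_lty (fin_num_measure mu).
exists M; split; first by rewrite num_real.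
by move=> x Mx y _ /=; rewrite (le_trans (fM y))// ltW.
Qed.

Lemma bintE f : bmeas f -> (\int[mu]_x (f x)%:E)%E = (\int[mu]_x f x)%:E.
Proof.
move=> bf; rewrite /Rintegral fineK//; apply: integrable_fin_num => //.
exact: bmeas_integrable.
Qed.

Lemma bintD f g : bmeas f -> bmeas g ->
  \int[mu]_x (f x + g x) = \int[mu]_x f x + \int[mu]_x g x.
Proof. by move=> bf bg; apply: RintegralD => //; exact: bmeas_integrable. Qed.

Lemma bintB f g : bmeas f -> bmeas g ->
  \int[mu]_x (f x - g x) = \int[mu]_x f x - \int[mu]_x g x.
Proof. by move=> bf bg; apply: RintegralB => //; exact: bmeas_integrable. Qed.

Lemma bintZ c f : bmeas f -> \int[mu]_x (c * f x) = c * \int[mu]_x f x.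
Proof. by move=> bf; apply: RintegralZl => //; exact: bmeas_integrable. Qed.

Lemma bint_le f g : bmeas f -> bmeas g -> (forall x, f x <= g x) ->
  \int[mu]_x f x <= \int[mu]_x g x.
Proof.
by move=> bf bg fg; apply: le_Rintegral => //; exact: bmeas_integrable.
Qed.

Lemma bint_cst c : \int[mu]_(_ in setT) c = c * fine (mu setT).
Proof. exact: Rintegral_cst. Qed.

Lemma bint_indic (A : set T) : measurable A ->
  \int[mu]_x (\1_A x : R) = fine (mu A).
Proof. by move=> mA; rewrite /Rintegral integral_indic// setIT. Qed.

Lemma bint_sum n (f : nat -> T -> R) : (forall k, bmeas (f k)) ->
  \int[mu]_x (\sum_(k < n) f k x) = \sum_(k < n) \int[mu]_x f k x.
Proof.
move=> bf; elim: n => [|n ih].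
  rewrite big_ord0; under eq_Rintegral do rewrite big_ord0.
  by rewrite (bint_cst 0) mul0r.
under eq_Rintegral do rewrite big_ord_recr /=.
by rewrite bintD// ?big_ord_recr/= ?ih//; exact: bmeas_sum.
Qed.

End BoundedMeasurable.

(** * Slopes of Lipschitz functions *)

Section Slope.
Context {R : realType} {X : completeMetricType R}.
Implicit Types f g u : X -> R.

Definition lip f := exists2 L, 0 <= L & forall x y, `|f x - f y| <= L * mdist x y.

Lemma lipP f : metric_lipschitz setT f <-> lip f.
Proof.
split=> [[L fL]|[L L0 fL]]; last by exists L => x y _ _.
exists `|L| => // x y; rewrite (le_trans (fL x y I I))//.
by rewrite ler_wpM2r ?mdist_ge0// ler_norm.
Qed.

(** For c >= 0 this is equivalent to slope f x <= c, and it avoids the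
    extended reals and the filter in the definition of the slope. *)
Definition slope_le f x (c : R) := forall e, 0 < e ->
  exists2 r, 0 < r & forall y, mdist x y < r -> `|f y - f x| <= (c + e) * mdist x y.

Lemma nbhs_mdist (x : X) (A : set X) :
  nbhs x A <-> exists2 r, 0 < r & forall y, mdist x y < r -> A y.
Proof.
rewrite -nbhs_ballE; split=> [[r r0 xA]|[r r0 xA]]; exists r => //= y.
  by move=> xy; apply: xA; rewrite ballEmdist.
by rewrite ballEmdist/= => xy; exact: xA.
Qed.

Lemma slope_le_slope f x c : 0 <= c -> (slope f x <= c%:E)%E <-> slope_le f x c.
Proof.
move=> c0; split.
  rewrite /slope ge_max => /andP[_ fc] e e0.
  have : (limf_esup (fun y => (`|f y - f x| / mdist x y)%:E) x^' < (c + e)%:E)%E.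
    by rewrite (le_lt_trans fc)// lte_fin ltrDl.
  rewrite limf_esupE => /ereal_inf_lt[_ [V /= xV <-]] Vc.
  move: xV => /nbhs_mdist[r r0 rV]; exists r => // y xy.
  have [->|yx] := eqVneq y x; first by rewrite mdistxx subrr normr0 mulr0.
  have d0 : 0 < mdist x y by rewrite mdist_gt0 eq_sym.
  rewrite -ler_pdivrMr// -lee_fin ltW// (le_lt_trans _ Vc)//.
  by apply: ereal_sup_ubound; exists y => //; exact: rV.
move=> fc; rewrite /slope ge_max lee_fin c0/=.
apply/lee_addgt0Pr => e e0; have [r r0 rf] := fc _ e0.
rewrite limf_esupE; apply: ereal_inf_le.
exists (ereal_sup ((fun y => (`|f y - f x| / mdist x y)%:E) @` [set y | mdist x y < r /\ y != x])).
  exists [set y | mdist x y < r /\ y != x] => //.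
  by apply/nbhs_mdist; exists r => // y xy yx; split.
apply: ge_ereal_sup => _ [y [xy yx] <-]; rewrite lee_fin ler_pdivrMr; first exact: rf.
by rewrite mdist_gt0 eq_sym.
Qed.

Lemma slope_ge0 f x : (0 <= slope f x)%E.
Proof. by rewrite /slope le_max lexx. Qed.

Definition rslope f x : R := fine (slope f x).

Lemma rslope_ge0 f x : 0 <= rslope f x.
Proof. exact/fine_ge0/slope_ge0. Qed.

Lemma rslopeE f x : lip f -> slope f x = (rslope f x)%:E.
Proof.
move=> [L L0 fL]; rewrite fineK// ge0_fin_numE ?slope_ge0//.
rewrite (@le_lt_trans _ _ L%:E) ?ltry//; apply/slope_le_slope => // e e0.
exists 1 => // y _; rewrite metric_sym (le_trans (fL _ _))//.
by rewrite ler_wpM2r ?mdist_ge0// lerDl ltW.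
Qed.

Lemma rslopeP f x c : lip f -> 0 <= c -> rslope f x <= c <-> slope_le f x c.
Proof. by move=> fl c0; rewrite -slope_le_slope// rslopeE// lee_fin. Qed.

Lemma rslope_slope_le f x : lip f -> slope_le f x (rslope f x).
Proof. by move=> fl; apply/rslopeP => //; exact: rslope_ge0. Qed.

(** The slope is the decreasing limit of these constants as r tends to 0;
    each of them is lower semicontinuous in x, so the slope is Borel. *)
Definition local_lip f (r : R) x : R :=
  sup [set `|f y - f x| / mdist x y | y in [set y | mdist x y < r]].

Section local_lip_lemmas.
Variables (f : X -> R) (L : R).
Hypotheses (L0 : 0 <= L) (fL : forall x y, `|f x - f y| <= L * mdist x y).

Let quot_le x y : `|f y - f x| / mdist x y <= L.
Proof.
have [->|yx] := eqVneq y x; first by rewrite subrr normr0 mul0r.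
by rewrite ler_pdivrMr ?mdist_gt0 1?eq_sym// metric_sym.
Qed.

Let has_sup_quot r x : 0 < r ->
  has_sup [set `|f y - f x| / mdist x y | y in [set y | mdist x y < r]].
Proof.
move=> r0; split; last by exists L => _ [y _ <-].
by exists (`|f x - f x| / mdist x x); exists x => //=; rewrite mdistxx.
Qed.

Lemma local_lip_ge r x y : mdist x y < r -> `|f y - f x| <= local_lip f r x * mdist x y.
Proof.
move=> xy; have r0 : 0 < r by rewrite (le_lt_trans _ xy)// mdist_ge0.
have [->|yx] := eqVneq y x; first by rewrite mdistxx subrr normr0 mulr0.
rewrite -ler_pdivrMr ?mdist_gt0 1?eq_sym//.
by apply: ub_le_sup; [exact: (has_sup_quot x r0).2|exists y].
Qed.

Lemma local_lip_le r x c : 0 < r -> 0 <= c ->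
  (forall y, mdist x y < r -> `|f y - f x| <= c * mdist x y) -> local_lip f r x <= c.
Proof.
move=> r0 c0 fc; apply: ge_sup; first exact: (has_sup_quot x r0).1.
move=> _ [y xy <-]; have [->|yx] := eqVneq y x; first by rewrite subrr normr0 mul0r.
by rewrite ler_pdivrMr ?mdist_gt0 1?eq_sym//; exact: fc.
Qed.

Lemma local_lip_ge0 r x : 0 < r -> 0 <= local_lip f r x.
Proof.
move=> r0; apply: le_trans (ub_le_sup (has_sup_quot x r0).2 _).
  2: by exists x => //=; rewrite mdistxx.
by rewrite subrr normr0 mul0r.
Qed.

Lemma local_lip_leL r x : 0 < r -> local_lip f r x <= L.
Proof. by move=> r0; apply: local_lip_le => // y _; rewrite metric_sym. Qed.

Lemma lip_near x e : 0 < e ->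
  exists2 r, 0 < r & forall x', mdist x x' < r -> `|f x' - f x| < e.
Proof.
move=> e0; exists (e / (L + 1)); first by rewrite divr_gt0// ltr_wpDl.
move=> x' xx'; rewrite distrC (le_lt_trans (fL _ _))//.
rewrite ltr_pdivlMr ?ltr_wpDl// in xx'; apply: le_lt_trans xx'.
by rewrite mulrC ler_wpM2l ?mdist_ge0// lerDl.
Qed.

(* A difference quotient exceeding c persists under small moves of x. *)
Lemma open_local_lip r c : 0 < r -> open [set x | c < local_lip f r x].
Proof.
move=> r0; rewrite openE => x /= cx; rewrite /interior.
have [c0|c0] := ltP c 0.
  apply/nbhs_mdist; exists 1 => // y _.
  by rewrite /= (lt_le_trans c0)// local_lip_ge0.
have [_ [y xy <-] cxy] := sup_gt (has_sup_quot x r0).1 cx.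
have yx : y != x.
  by apply: contraTneq cxy => ->; rewrite subrr normr0 mul0r -leNgt.
have d0 : 0 < mdist x y by rewrite mdist_gt0 eq_sym.
rewrite ltr_pdivlMr// in cxy.
pose e := (`|f y - f x| - c * mdist x y) / (1 + c).
have c1 : 0 < 1 + c by rewrite ltr_wpDr.
have e0 : 0 < e by rewrite divr_gt0// subr_gt0.
have [s s0 sx] := lip_near x e0.
apply/nbhs_mdist; exists (Num.min s (Num.min (r - mdist x y) (Num.min e (mdist x y)))).
  by rewrite !lt_min s0 subr_gt0 xy e0 d0.
move=> x' /=; rewrite !lt_min => /and4P[x's x'r x'e x'd].
have x'y : mdist x' y < r.
  rewrite (le_lt_trans (metric_triangle _ x _))// metric_sym.
  by rewrite -ltrBrDr.
have d'0 : 0 < mdist x' y.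
  rewrite mdist_gt0; apply: contraTneq x'd => ->.
  by rewrite ltxx.
apply: lt_le_trans (ub_le_sup (has_sup_quot x' r0).2 _); last by exists y.
rewrite ltr_pdivlMr//.
have tri : mdist x' y <= mdist x x' + mdist x y.
  by rewrite (metric_sym x x') metric_triangle.
have h1 : `|f y - f x| <= `|f y - f x'| + `|f x' - f x|.
  by rewrite (le_trans _ (ler_normD _ _))// addrA subrK.
have h2 := sx _ x's.
have h3 : c * mdist x' y <= c * (mdist x x' + mdist x y) by rewrite ler_wpM2l.
have h4 : c * mdist x x' <= c * e by rewrite ler_wpM2l// ltW.
have h5 : e * (1 + c) = `|f y - f x| - c * mdist x y by rewrite mulfVK// gt_eqF.
rewrite mulrDr in h3; lra.
Qed.

Lemma rslope_le_local_lip r x : 0 < r -> rslope f x <= local_lip f r x.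
Proof.
move=> r0; apply/rslopeP; [by exists L|exact: local_lip_ge0|] => e e0.
exists r => // y xy; rewrite (le_trans (local_lip_ge xy))//.
by rewrite ler_wpM2r ?mdist_ge0// lerDl ltW.
Qed.

Lemma rslope_leL x : rslope f x <= L.
Proof. exact: le_trans (rslope_le_local_lip x ltr01) (local_lip_leL x ltr01). Qed.

Lemma cvg_local_lip x : local_lip f (n.+1%:R^-1) x @[n --> \oo] --> rslope f x.
Proof.
apply/cvgrPdist_lt => e e0; have e2 : 0 < e / 2 by rewrite divr_gt0.
have [r r0 rf] : exists2 r, 0 < r &
    forall y, mdist x y < r -> `|f y - f x| <= (rslope f x + e / 2) * mdist x y.
  by apply: rslope_slope_le => //; exists L.
near=> n; have n0 : 0 < n.+1%:R^-1 :> R by rewrite invr_gt0.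
rewrite distrC ger0_norm ?subr_ge0 ?rslope_le_local_lip// ltrBlDl.
have : local_lip f n.+1%:R^-1 x <= rslope f x + e / 2.
  apply: local_lip_le => //; first by rewrite addr_ge0 ?rslope_ge0// ltW.
  move=> y xy; apply: rf; rewrite (lt_trans xy)//.
  by near: n; exact: (near_infty_natSinv_lt (PosNum r0)).
lra.
Unshelve. all: end_near. Qed.

End local_lip_lemmas.

Lemma measurable_superlevel f : (forall c, open [set x | c < f x]) ->
  measurable_fun [set: borel X] (f : borel X -> R).
Proof.
move=> of_ _; apply: (measurability _ (RGenOInfty.measurableE R)) => //.
move=> _ [_ [c ->] <-]; apply: measurableI => //.
apply: sub_sigma_algebra; rewrite [X in open X](_ : _ = [set x | c < f x])//.
by apply/seteqP; split => x /=; rewrite in_itv/= andbT.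
Qed.

Lemma lip_open f c : lip f -> open [set x | c < f x].
Proof.
move=> [L L0 fL]; rewrite openE => x /= cx; apply/nbhs_mdist.
have [r r0 rx] := lip_near L0 fL x (etrans (subr_gt0 _ _) cx).
exists r => // y /rx /=; rewrite ltr_norml => /andP[+ _].
by rewrite opprB ltrBlDr subrK.
Qed.

Lemma lip_measurable f : lip f -> measurable_fun [set: borel X] (f : borel X -> R).
Proof. by move=> fl; apply: measurable_superlevel => c; exact: lip_open. Qed.

Lemma measurable_local_lip f r : lip f -> 0 < r ->
  measurable_fun [set: borel X] (local_lip f r : borel X -> R).
Proof.
move=> [L L0 fL] r0; apply: measurable_superlevel => c; exact: (open_local_lip L0 fL).
Qed.

Lemma measurable_rslope f : lip f -> measurable_fun [set: borel X] (rslope f : borel X -> R).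
Proof.
move=> fl; apply: (@measurable_fun_cvg _ (borel X) R setT (fun n => local_lip f n.+1%:R^-1)).
  by move=> n; apply: measurable_local_lip.
by move=> x _; case: fl => L L0 fL; exact: (cvg_local_lip L0 fL).
Qed.

Lemma bmeas_local_lip f r : lip f -> 0 < r -> bmeas (local_lip f r : borel X -> R).
Proof.
move=> fl r0; split; first exact: measurable_local_lip.
case: fl => L L0 fL; exists L => x.
by rewrite ger0_norm ?(local_lip_ge0 L0 fL)// (local_lip_leL L0 fL).
Qed.

Lemma bmeas_rslope f : lip f -> bmeas (rslope f : borel X -> R).
Proof.
move=> fl; split; first exact: measurable_rslope.
by case: fl => L L0 fL; exists L => x; rewrite ger0_norm ?rslope_ge0// (rslope_leL L0 fL).
Qed.

(** Chain rule. Only the growth of B near the value f x matters; the form with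
    k + e covers derivatives as well as the kinks of truncations. *)
Lemma slope_comp (B : R -> R) f x k : lip f -> lip (B \o f) -> 0 <= k ->
  (forall e, 0 < e -> exists2 s, 0 < s & forall t, `|t - f x| < s ->
     `|B t - B (f x)| <= (k + e) * `|t - f x|) ->
  rslope (B \o f) x <= k * rslope f x.
Proof.
move=> fl Bfl k0 Bk; have s0 := rslope_ge0 f x.
apply/rslopeP => //; first by rewrite mulr_ge0.
move=> e e0; pose S := rslope f x; pose e1 := Num.min 1 (e / (k + S + 1)).
have q0 : 0 < k + S + 1 by rewrite ltr_wpDl// addr_ge0.
have e10 : 0 < e1 by rewrite lt_min ltr01 divr_gt0.
have [s s1 sB] := Bk _ e10.
have [r r0 rf] := rslope_slope_le x fl e10.
case: (fl) => L L0 fL; have [r' r'0 rf'] := lip_near L0 fL x s1.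
exists (Num.min r r'); first by rewrite lt_min r0.
move=> y; rewrite lt_min => /andP[xr xr'] /=.
rewrite (le_trans (sB _ (rf' _ xr')))//.
rewrite (@le_trans _ _ ((k + e1) * ((S + e1) * mdist x y)))//.
  by rewrite ler_wpM2l ?rf//; rewrite addr_ge0// ltW.
rewrite mulrA ler_wpM2r ?mdist_ge0//.
have e1e : e1 * (k + S + 1) <= e.
  by rewrite -ler_pdivlMr// ge_min lexx orbT.
have e11 : e1 * e1 <= e1 * 1 by rewrite ler_wpM2l ?(ltW e10)// /e1 ge_min lexx.
rewrite -/S; nra.
Qed.

Lemma lip_bounded (D : R) f : (forall x y : X, mdist x y <= D) -> lip f ->
  exists M, forall x, `|f x| <= M.
Proof.
move=> XD [L L0 fL]; exists (`|f point| + L * D) => x.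
rewrite -[f x](subrK (f point)) addrC (le_trans (ler_normD _ _))// lerD2l.
by rewrite (le_trans (fL _ _))// ler_wpM2l.
Qed.

End Slope.

(** * The L1 form of Cheeger's isoperimetric inequality *)

Lemma le_limn_einf {R : realType} (u v : (\bar R)^nat) :
  (forall n, u n <= v n)%E -> (limn_einf u <= limn_einf v)%E.
Proof.
move=> uv; rewrite /limn_einf leeN2 /limn_esup !limf_esupE.
apply: le_ereal_inf_tmp => _ [V /= oV <-].
apply: ereal_inf_le; exists (ereal_sup ((\- v)%E @` V)); first by exists V.
apply: ge_ereal_sup => _ [n Vn <-] /=.
apply: (@le_trans _ _ (- u n)%E); first by rewrite leeN2.
by apply: ereal_sup_ubound; exists n.
Qed.

(** As n grows these Lipschitz functions increase to the indicator of s > t. *)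
Definition ramp {R : realType} (n : nat) (t s : R) : R :=
  Num.min 1 (n.+1%:R * Num.max 0 (s - t)).

Section Ramp.
Context {R : realType}.
Implicit Types (n : nat) (s t : R).

Lemma ramp_lip n t s s' : `|ramp n t s - ramp n t s'| <= n.+1%:R * `|s - s'|.
Proof.
wlog ss' : s s' / s' <= s.
  move=> W; case: (leP s' s) => [/W//|/ltW/W].
  by rewrite (distrC s') (distrC (ramp _ _ s')).
have n0 : 0 <= n.+1%:R :> R by [].
rewrite (ger0_norm (_ : 0 <= s - s')) ?subr_ge0//.
have h1 : n.+1%:R * Num.max 0 (s' - t) <= n.+1%:R * Num.max 0 (s - t).
  by rewrite ler_wpM2l// ge_max le_max lexx/= le_max lerB// orbT.
have h2 : n.+1%:R * Num.max 0 (s - t) <= n.+1%:R * (Num.max 0 (s' - t) + (s - s')).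
  rewrite ler_wpM2l// ge_max; apply/andP; split.
    by rewrite addr_ge0 ?subr_ge0// le_max lexx.
  by apply: (@le_trans _ _ ((s' - t) + (s - s'))); [lra|rewrite lerD2r le_max lexx orbT].
rewrite mulrDr in h2.
rewrite ger0_norm /ramp; last first.
  by rewrite subr_ge0 le_min ge_min lexx/= ge_min h1 orbT.
have h3 : 0 <= n.+1%:R * (s - s') by rewrite mulr_ge0// subr_ge0.
rewrite lerBlDr; rewrite /Num.min; do 2 case: ifP; rewrite -?leNgt => _; lra.
Qed.

Lemma ramp_ge0 n t s : 0 <= ramp n t s.
Proof. by rewrite le_min ler01/= mulr_ge0// le_max lexx. Qed.

Lemma ramp_le1 n t s : ramp n t s <= 1.
Proof. by rewrite ge_min lexx. Qed.

Lemma ramp0 n t s : s <= t -> ramp n t s = 0.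
Proof.
move=> st; rewrite /ramp (@max_l _ _ 0) ?subr_le0// mulr0.
by apply/min_idPr; exact: ler01.
Qed.

Lemma ramp1 n t s : t + n.+1%:R^-1 <= s -> ramp n t s = 1.
Proof.
move=> ts; apply/min_idPl.
rewrite -[leLHS](@mulfV _ n.+1%:R)// ler_wpM2l// le_max.
by apply/orP; right; rewrite lerBrDl.
Qed.

Lemma ramp_flat n t s : ~~ (t <= s <= t + n.+1%:R^-1) ->
  exists2 e : R, 0 < e & forall s' : R, `|s' - s| < e -> ramp n t s' = ramp n t s.
Proof.
rewrite negb_and -!ltNge => /orP[st|ts].
  exists (t - s); first by rewrite subr_gt0.
  move=> s'; rewrite ltr_norml ltrD2r => /andP[_ s't].
  by rewrite !ramp0 ?(ltW st) ?(ltW s't).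
exists (s - (t + n.+1%:R^-1)); first by rewrite subr_gt0.
move=> s'; rewrite ltr_norml opprB ltrD2r => /andP[s's _].
by rewrite !ramp1 ?(ltW ts) ?(ltW s's).
Qed.

End Ramp.

Section CheegerL1.
Context {R : realType} {X : completeMetricType R}.
Variables (m : {finite_measure set (borel X) -> \bar R}).

Lemma rslope_ramp (w : X -> R) n t x : lip w ->
  rslope (ramp n t \o w) x <=
  n.+1%:R * rslope w x * \1_[set x | t <= w x <= t + n.+1%:R^-1] x.
Proof.
move=> wl; have rl : lip (ramp n t \o w).
  case: (wl) => L L0 wL; exists (n.+1%:R * L); first by rewrite mulr_ge0.
  by move=> y z; rewrite (le_trans (ramp_lip _ _ _ _))// -mulrA ler_wpM2l.
rewrite indicE; case: (boolP (_ \in _)) => [_|xA] /=.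
  rewrite mulr1; apply: slope_comp => // e e0.
  exists 1 => // s _; rewrite (le_trans (ramp_lip _ _ _ _))//.
  by rewrite ler_wpM2r// lerDl ltW.
have /ramp_flat[e e0 flat] : ~~ (t <= w x <= t + n.+1%:R^-1).
  by apply: contra xA => tw; rewrite mem_set.
rewrite mulr0 -[leRHS](mul0r (rslope w x)); apply: slope_comp => // d d0.
exists e => // s /flat ->; rewrite subrr normr0 add0r mulr_ge0//.
exact: ltW.
Qed.

(** The ramps of w above t are competitors in the definition of the perimeter
    of the superlevel set. *)
Lemma perimeter_superlevel (w : X -> R) t : lip w ->
  (perimeter m [set x | (t < w x)%R] <=
   limn_einf (fun n => \int[m]_x
     (n.+1%:R * rslope w x * \1_[set x | t <= w x <= t + n.+1%:R^-1]%R x)%:E))%E.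
Proof.
move=> wl; have rl n : lip (ramp n t \o w).
  case: (wl) => L L0 wL; exists (n.+1%:R * L); first by rewrite mulr_ge0.
  by move=> y z; rewrite (le_trans (ramp_lip _ _ _ _))// -mulrA ler_wpM2l.
have mA : measurable ([set x | (t < w x)%R] : set (borel X)).
  by apply: sub_sigma_algebra; exact: lip_open.
have mS n : measurable ([set x | t <= w x <= t + n.+1%:R^-1] : set (borel X)).
  have := lip_measurable wl measurableT (measurable_itv `[t, (t + n.+1%:R^-1)]).
  by rewrite setTI; congr measurable; apply/seteqP; split => x /=; rewrite in_itv.
apply: (@le_trans _ _ (limn_einf (fun n => \int[m]_x slope (ramp n t \o w) x)))%E.
  apply: ereal_inf_lbound; exists (fun n => ramp n t \o w) => //; split.
    move=> n A _; case/lipP: (rl n) => L lL; exists L => x y _ _; exact: lL.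
  rewrite -[X in _ --> X](@integral0 _ _ R m setT).
  apply: (@dominated_cvg _ _ _ m setT _ _ _ (EFin \o cst 1)) => //.
  - move=> n; apply/measurable_EFinP; apply: measurableT_comp => //.
    apply: measurable_funB; last exact: measurable_indic.
    exact: lip_measurable.
  - move=> x _; apply/cvg_EFin; first by near=> n.
    apply: cvg_near_cst; have [wt|tw] := leP (w x) t.
      near=> n; rewrite /= indicE memNset/=; first by rewrite ramp0// subrr normr0.
      by apply/negP; rewrite -leNgt.
    have tw0 : 0 < w x - t by rewrite subr_gt0.
    near=> n; rewrite /= indicE mem_set//= ramp1 ?subrr ?normr0//.
    rewrite -lerBrDl ltW//; near: n.
    exact: (near_infty_natSinv_lt (PosNum tw0)).
  - exact: finite_measure_integrable_cst.
  - move=> n x _ /=; rewrite lee_fin normr_id.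
    have := ramp_ge0 n t (w x); have := ramp_le1 n t (w x).
    by rewrite indicE; case: (_ \in _) => /=; rewrite ler_norml; lra.
apply: le_limn_einf => n; apply: ge0_le_integral => //.
- by move=> x _; exact: slope_ge0.
- rewrite (_ : slope _ = EFin \o rslope (ramp n t \o w)).
    by apply/measurable_EFinP; exact: measurable_rslope.
  by apply/funext => x; rewrite /= rslopeE.
- apply/measurable_EFinP; apply: measurable_funM; last exact: measurable_indic.
  by apply: measurable_funM => //; exact: measurable_rslope.
- by move=> x _; rewrite rslopeE// lee_fin rslope_ramp.
Unshelve. all: end_near. Qed.

Lemma perimeter_ge0 (A : set X) : (0 <= perimeter m A)%E.
Proof.
apply: le_ereal_inf_tmp => _ [F _ <-]; rewrite -[leLHS](_ : limn_einf (cst 0%E) = _).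
  by apply: le_limn_einf => n; apply: integral_ge0 => x _; exact: slope_ge0.
by apply: (cvg_limn_einf_sup _).1; exact: cvg_cst.
Qed.

Lemma cheeger_constant_ge0 : (0 <= cheeger_constant m)%E.
Proof.
apply: le_ereal_inf_tmp => _ [A _ <-].
by rewrite mule_ge0 ?perimeter_ge0// inve_ge0.
Qed.

(** Coarea: the Cheeger inequality for the superlevel set at height t reads
    h m(w > t) <= liminf of mean slopes over thin slabs above t; integrating in
    t, Fatou's lemma and Tonelli's theorem give the claim, because each point x
    lies in the slabs of thickness 1/n only for t in an interval of that length. *)
Lemma cheeger_L1 (w : X -> R) : lip w -> (exists M, forall x, `|w x| <= M) ->
  (forall x, 0 <= w x) ->
  (m [set x | (0 < w x)%R] <= 2^-1%:E * m setT)%E ->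
  (cheeger_constant m * (\int[m]_x w x)%:E <= (\int[m]_x rslope w x)%:E)%E.
Proof.
move=> wl wb w0 wh.
have mw := lip_measurable wl; have bw : bmeas (w : borel X -> R) by split.
pose leb := @lebesgue_measure R.
pose J (z : borel X * measurableTypeR R) : \bar R :=
  (\1_[set z | 0 <= z.2 < w z.1]%R z)%:E.
pose Jn n (z : borel X * measurableTypeR R) : \bar R :=
  (n.+1%:R * rslope w z.1 *
    \1_[set z | w z.1 - n.+1%:R^-1 <= z.2 <= w z.1]%R z)%:E.
have mw1 : measurable_fun setT (fun z : borel X * measurableTypeR R => w z.1).
  exact: (measurableT_comp mw).
have mpred (P : borel X * measurableTypeR R -> bool) :
    measurable_fun setT P -> measurable [set z | P z].
  move=> mP; have := mP measurableT [set true].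
  by rewrite setTI; apply.
have mJ : measurable_fun setT J.
  apply/measurable_EFinP/measurable_indic.
  apply: (mpred (fun z => 0 <= z.2 < w z.1)).
  by apply: measurable_and; [exact: measurable_fun_ler|exact: measurable_fun_ltr].
have mJn n : measurable_fun setT (Jn n).
  apply/measurable_EFinP; apply: measurable_funM.
    by apply: measurable_funM => //; exact: (measurableT_comp (measurable_rslope wl)).
  apply/measurable_indic.
  apply: (mpred (fun z => w z.1 - n.+1%:R^-1 <= z.2 <= w z.1)).
  apply: measurable_and; apply: measurable_fun_ler => //.
  exact: measurable_funB.
have J0 z : (0 <= J z)%E by rewrite lee_fin.
have Jn0 n z : (0 <= Jn n z)%E by rewrite lee_fin !mulr_ge0// rslope_ge0.
have intJ : (\int[leb]_t \int[m]_x J (x, t) = (\int[m]_x w x)%:E)%E.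
  rewrite -(@fubini_tonelli _ _ _ _ _ m leb J)// -bintE//.
  apply: eq_integral => x _.
  transitivity (\int[leb]_t (\1_`[0, (w x)[%classic t)%:E)%E.
    apply: eq_integral => t _; rewrite /J !indicE; congr (_%:R)%:E; congr nat_of_bool.
  rewrite integral_indic// setIT; apply: etrans (lebesgue_measure_itv _) _ => /=.
  rewrite lte_fin oppr0 addr0; case: ltP => // wx.
  by congr EFin; apply/eqP; rewrite eq_le w0 wx.
have intJn n : (\int[leb]_t \int[m]_x Jn n (x, t) <= (\int[m]_x rslope w x)%:E)%E.
  rewrite -(@fubini_tonelli _ _ _ _ _ m leb (Jn n))// -bintE; last exact: bmeas_rslope.
  apply: ge0_le_integral => //.
  - by move=> x _; exact: integral_ge0.
  - exact: (@measurable_fun_fubini_tonelli_F _ _ _ _ _ leb (Jn n)).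
  - by apply/measurable_EFinP; exact: measurable_rslope.
  move=> x _; rewrite (_ : (\int[leb]_t Jn n (x, t) = \int[leb]_t
      (n.+1%:R * rslope w x * \1_`[(w x - n.+1%:R^-1)%R, (w x)]%classic t)%:E)%E); last first.
    apply: eq_integral => t _; rewrite /Jn !indicE /=; congr (_ * _%:R)%:E; congr nat_of_bool.
  under eq_integral do rewrite EFinM.
  rewrite ge0_integralZl//; last 2 first.
  - by apply/measurable_EFinP/measurable_indic.
  - by rewrite lee_fin mulr_ge0// rslope_ge0.
  rewrite integral_indic// setIT.
  rewrite [X in (_ * X)%E](lebesgue_measure_itv `[(w x - n.+1%:R^-1), (w x)]) /=.
  rewrite lte_fin ltrBlDr ltrDl invr_gt0 ltr0Sn -EFinD -EFinM lee_fin.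
  by rewrite opprB addrCA subrr addr0 mulrAC mulfV// mul1r.
have key t : (cheeger_constant m * \int[m]_x J (x, t) <=
    limn_einf (fun n => \int[m]_x Jn n (x, t)))%E.
  have rhs0 : (0 <= limn_einf (fun n => \int[m]_x Jn n (x, t)))%E.
    rewrite -[leLHS](_ : limn_einf (cst 0%E) = _).
      by apply: le_limn_einf => n; exact: integral_ge0.
    by apply: (cvg_limn_einf_sup _).1; exact: cvg_cst.
  have [t0|t0] := ltP t 0.
    rewrite [X in (_ * X)%E](_ : _ = 0%E) ?mule0//.
    apply: integral0_eq => x _; rewrite /J indicE memNset//=.
    by rewrite leNgt t0.
  pose A : set (borel X) := [set x | (t < w x)%R].
  have mA : measurable A by apply: sub_sigma_algebra; exact: lip_open.
  have intJt : (\int[m]_x J (x, t) = m A)%E.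
    transitivity (\int[m]_x (\1_A x)%:E)%E.
      apply: eq_integral => x _; rewrite /J !indicE; congr (_%:R)%:E; congr nat_of_bool.
      by apply/idP/idP => /set_mem/= h; apply/mem_set; rewrite /= ?t0// in h *.
    by rewrite integral_indic// setIT.
  rewrite intJt.
  have mAfin : m A \is a fin_num by exact: fin_num_measure.
  have [mA0|mA0] := eqVneq (m A) 0%E; first by rewrite mA0 mule0.
  have mApos : (0 < m A)%E by rewrite lt0e mA0 measure_ge0.
  have hA : (cheeger_constant m <= perimeter m A / m A)%E.
    apply: ereal_inf_lbound; exists A => //; split => //.
    apply: le_trans wh; apply: le_measure; rewrite ?inE//.
      by apply: sub_sigma_algebra; exact: lip_open.
    by move=> x; exact: le_lt_trans.
  apply: (@le_trans _ _ (perimeter m A)).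
    have r0 : (0 < fine (m A))%R by rewrite fine_gt0// mApos ltey_eq mAfin.
    by move: hA; rewrite -(fineK mAfin) inver gt_eqF// lee_pdivlMr.
  apply: le_trans (perimeter_superlevel t wl) _; apply: le_limn_einf => n.
  rewrite le_eqVlt; apply/orP; left; apply/eqP; apply: eq_integral => x _.
  rewrite /Jn; congr (_ * _)%:E; rewrite !indicE; congr (_%:R); congr nat_of_bool.
  apply/idP/idP => /set_mem/= h; apply/mem_set => /=; move: h;
    by rewrite lerBlDr andbC.
rewrite -intJ -ge0_integralZl//; last 3 first.
- exact: (@measurable_fun_fubini_tonelli_G _ _ _ _ _ m J).
- by move=> t _; exact: integral_ge0.
- exact: cheeger_constant_ge0.
apply: (@le_trans _ _ (\int[leb]_t limn_einf (fun n => \int[m]_x Jn n (x, t))))%E.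
  apply: ge0_le_integral => //.
  - move=> t _; rewrite mule_ge0 ?cheeger_constant_ge0//; exact: integral_ge0.
  - apply: measurable_funeM; exact: (@measurable_fun_fubini_tonelli_G _ _ _ _ _ m J).
  - apply: measurableT_comp => //; apply: measurable_fun_limn_esup => n.
    apply: measurableT_comp => //.
    exact: (@measurable_fun_fubini_tonelli_G _ _ _ _ _ m (Jn n)).
apply: le_trans (fatou _ _ _ _) _ => //.
- by move=> n; exact: (@measurable_fun_fubini_tonelli_G _ _ _ _ _ m (Jn n)).
- by move=> n t _; exact: integral_ge0.
rewrite -[leRHS](_ : limn_einf (cst (\int[m]_x rslope w x)%:E) = _).
  exact: le_limn_einf.
by apply: (cvg_limn_einf_sup _).1; exact: cvg_cst.
Qed.

End CheegerL1.

(** * Densities and entropy *)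

Section Entropy.
Context {R : realType} {X : completeMetricType R}.
Variables (m : {finite_measure set (borel X) -> \bar R}).
Implicit Types (mu : probability (borel X) R) (rho : X -> R).

Lemma density_dominated mu rho : density m mu rho -> mu `<< m.
Proof.
move=> [mrho rho0 murho]; apply/null_content_dominatesP => A mA mA0.
rewrite murho//; apply: null_set_integral => //.
by apply/measurable_EFinP; apply: measurable_funTS.
Qed.

Lemma density_integrable mu rho : density m mu rho ->
  m.-integrable setT (EFin \o rho : borel X -> \bar R).
Proof.
move=> [mrho rho0 murho]; apply/integrableP; split; first exact/measurable_EFinP.
under eq_integral do rewrite gee0_abs ?lee_fin//.
by rewrite -murho// probability_setT ltry.
Qed.

Lemma density_ae_eq mu rho rho' : density m mu rho -> density m mu rho' ->
  ae_eq m setT (EFin \o rho : borel X -> \bar R) (EFin \o rho').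
Proof.
move=> d d'; apply: integral_ae_eq => //.
- exact: density_integrable d.
- by apply/measurable_EFinP; case: d'.
- move=> A _ mA; case: d => _ _ <- //; case: d' => _ _ <- //.
Qed.

Lemma density_int mu rho (f : borel X -> R) : density m mu rho -> bmeas f ->
  \int[mu]_x f x = \int[m]_x (f x * rho x).
Proof.
move=> d bf; have dom := density_dominated d; congr fine.
rewrite -(Radon_Nikodym_change_of_variables dom)//; last exact: bmeas_integrable.
case: (bf) => mf _; case: (d) => mrho _ murho.
apply: ae_eq_integral => //.
- apply: emeasurable_funM; first exact/measurable_EFinP.
  exact: measurable_int (Radon_Nikodym_integrable _).
- by apply/measurable_EFinP; exact: measurable_funM.
have : ae_eq m setT (Radon_Nikodym (charge_of_finite_measure mu) m)
    (EFin \o rho : borel X -> \bar R).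
  apply: integral_ae_eq => //.
  - exact: Radon_Nikodym_integrable.
  - exact/measurable_EFinP.
  - by move=> A _ mA; rewrite -Radon_Nikodym_integral//= murho.
by apply: filterS => x /= /(_ I) ->.
Qed.

Lemma bmeas_density_integrable mu rho (f : borel X -> R) :
  density m mu rho -> bmeas f ->
  m.-integrable setT (fun x : borel X => (f x * rho x)%:E).
Proof.
move=> d [mf [M fM]]; have ir := density_integrable d; case: (d) => mrho rho0 _.
apply: (@le_integrable _ _ _ m setT measurableT _ (fun x => (`|M|%:E * (rho x)%:E)%E)).
- by apply/measurable_EFinP; exact: measurable_funM.
- move=> x _; rewrite /= lee_fin normrM (ger0_norm (rho0 x)).
  rewrite [leRHS]ger0_norm ?mulr_ge0// ler_wpM2r//.
  by rewrite (le_trans (fM x))// ler_norm.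
- exact: integrableZl.
Qed.

(** Fenchel's inequality for r ln r, whose convex conjugate is exp (g - 1). *)
Lemma fenchel_xlnx (r g : R) : 0 <= r -> r * g + r - expR g <= r * ln r.
Proof.
rewrite le_eqVlt => /predU1P[<-|r0]; first by rewrite !mul0r !add0r oppr_le0 expR_ge0.
have := expR_ge1Dx (g - ln r); rewrite expRB lnK ?posrE// ler_pdivlMr//.
lra.
Qed.

(** Duality: the entropy dominates the affine functionals attached to the
    densities exp g. The value xget of Ent, whichever density it selects, obeys
    the pointwise inequality of fenchel_xlnx. *)
Lemma Ent_lower mu (g : borel X -> R) : bmeas g ->
  \int[m]_x expR (g x) <= 1 -> ((\int[mu]_x g x)%:E <= Ent m mu)%E.
Proof.
move=> bg ig1; rewrite /Ent; case: xgetP; last by rewrite leey.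
move=> e _ [rho [d _ ->]]; case: (bg) => mg [M gM]; case: (d) => mrho rho0 murho.
have beg : bmeas (fun x : borel X => expR (g x)).
  split; first exact: measurableT_comp.
  exists (expR M) => x; rewrite ger0_norm ?expR_ge0// ler_expR.
  by rewrite (le_trans _ (gM x))// ler_norm.
pose j (x : borel X) := g x * rho x + rho x - expR (g x).
have igr := bmeas_density_integrable d bg.
have ir := density_integrable d.
have ieg := bmeas_integrable m beg.
have mj : measurable_fun setT j.
  apply: measurable_funB; last by case: beg.
  by apply: measurable_funD => //; exact: measurable_funM.
apply: (@le_trans _ _ (\int[m]_x (j x)%:E)%E).
  have -> : (\int[m]_x (j x)%:E = \int[m]_x (g x * rho x)%:E + \int[m]_x (rho x)%:E
      - \int[m]_x (expR (g x))%:E)%E.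
    rewrite -integralD// -integralB//; last exact: integrableD.
  rewrite -murho// probability_setT (density_int d)// /Rintegral fineK.
    rewrite -addeA leeDl//.
    by rewrite bintE// -EFinB lee_fin subr_ge0.
  exact: integrable_fin_num.
have mr : measurable_fun setT (fun x : borel X => (rho x * ln (rho x))%:E).
  apply/measurable_EFinP; apply: measurable_funM => //.
  by apply: measurableT_comp => //; exact: measurable_ln.
have jle : {in setT, forall x : borel X, ((j x)%:E <= (rho x * ln (rho x))%:E)%E}.
  by move=> x _; rewrite lee_fin /j mulrC fenchel_xlnx.
rewrite [leLHS]integralE [leRHS]integralE leeB//.
- apply: ge0_le_integral => //.
  + by apply: measurable_funepos; exact/measurable_EFinP.
  + exact: measurable_funepos.
  + by move=> x _; apply: (funepos_le jle); rewrite in_setT.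
- apply: ge0_le_integral => //.
  + exact: measurable_funeneg.
  + by apply: measurable_funeneg; exact/measurable_EFinP.
  + by move=> x _; apply: (funeneg_le jle); rewrite in_setT.
Qed.

Lemma bmeas_xlnx (rho : borel X -> R) : bmeas rho -> (forall x, 0 <= rho x) ->
  bmeas (fun x => rho x * ln (rho x)).
Proof.
move=> [mr [M rM]] r0; split.
  apply: measurable_funM => //.
  by apply: measurableT_comp => //; exact: measurable_ln.
exists (1 + M * M) => x; have := fenchel_xlnx 0 (r0 x).
rewrite mulr0 add0r expR0 => h1.
have rMx : rho x <= M by rewrite (le_trans _ (rM x))// ler_norm.
have h2 : rho x * ln (rho x) <= M * M.
  have [->|rx] := eqVneq (rho x) 0; first by rewrite mul0r mulr_ge0// (le_trans (r0 x)).
  have rp : 0 < rho x by rewrite lt0r rx r0.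
  have := ln_sublinear rp => h; rewrite (@le_trans _ _ (rho x * rho x))//.
    by rewrite ler_wpM2l// ltW.
  by rewrite ler_pM.
have h3 := r0 x; have h4 : 0 <= M * M by rewrite mulr_ge0 ?(le_trans (r0 x)).
by rewrite ler_norml; lra.
Qed.

(** Two densities of the same measure agree almost everywhere, so the choice
    made by xget does not matter. *)
Lemma Ent_density mu (rho : borel X -> R) : density m mu rho -> bmeas rho ->
  Ent m mu = (\int[m]_x (rho x * ln (rho x)))%:E.
Proof.
move=> d br; case: (d) => mrho rho0 murho.
have bx := bmeas_xlnx br rho0; have ix := bmeas_integrable m bx.
rewrite -bintE//; apply: xget_unique.
  exists rho; split => //; exact: integral_funeneg_lt_pinfty.
move=> _ [rho' [d' _ ->]]; case: (d') => mrho' _ _.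
apply: ae_eq_integral => //.
- apply/measurable_EFinP; apply: measurable_funM => //.
  by apply: measurableT_comp => //; exact: measurable_ln.
- by apply/measurable_EFinP; case: bx.
by apply: filterS (density_ae_eq d' d) => x /= /(_ I) [->].
Qed.

End Entropy.

(** * The distance as a measurable cost *)

Section Cost.
Context {R : realType} {X : completeMetricType R}.
Variable D : R.
Hypothesis XD : forall x y : X, mdist x y <= D.
Hypothesis Xsep : exists2 S : set X, countable S & dense S.

Lemma lip_mdist (x : X) : lip (mdist x).
Proof.
exists 1 => // y z; rewrite mul1r ler_norml; apply/andP; split.
  by have := metric_triangle x y z; lra.
by have := metric_triangle x z y; rewrite (metric_sym z y); lra.
Qed.

(** The product sigma-algebra sees the distance because it is the infimum of
    d(s, x) + d(s, y) over s in a countable dense set. *)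
Lemma measurable_mdist :
  measurable_fun setT (fun z : borel X * borel X => mdist (z.1 : X) z.2).
Proof.
case: Xsep => S cS dS.
have ms s : measurable_fun setT
    (fun z : borel X * borel X => mdist s (z.1 : X) + mdist s (z.2 : X)).
  apply: measurable_funD.
    exact: (measurableT_comp (lip_measurable (lip_mdist s)) measurable_fst).
  exact: (measurableT_comp (lip_measurable (lip_mdist s)) measurable_snd).
move=> _; apply: (measurability _ (RGenInftyO.measurableE R)) => //.
move=> _ [_ [c ->] <-]; rewrite setTI.
have -> : (fun z : borel X * borel X => mdist (z.1 : X) z.2) @^-1` `]-oo, c[ =
    \bigcup_(s in S) [set z | mdist s (z.1 : X) + mdist s (z.2 : X) < c].
  apply/seteqP; split=> [[x y]|[x y] [s _]] /=; rewrite in_itv/=.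
    move=> xyc; have e0 : 0 < (c - mdist x y) / 2 by rewrite divr_gt0// subr_gt0.
    have [s [xs Ss]] : [set s | mdist x s < (c - mdist x y) / 2] `&` S !=set0.
      apply: dS; first by exists x; rewrite /= mdistxx.
      rewrite openE => s /= xs; apply/nbhs_mdist.
      exists ((c - mdist x y) / 2 - mdist x s); first by rewrite subr_gt0.
      by move=> y' sy' /=; have := metric_triangle x s y'; lra.
    exists s => //=; have := metric_triangle s x y; rewrite (metric_sym s x) /= in xs *.
    lra.
  by move=> /= h; have := metric_triangle x s y; rewrite (metric_sym x s); lra.
have mF s : measurable [set z : borel X * borel X | mdist s (z.1 : X) + mdist s (z.2 : X) < c].
  have := ms s measurableT (`]-oo, c[)%classic (measurable_itv _); rewrite setTI.
  by congr measurable; apply/seteqP; split => z /=; rewrite in_itv.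
case/pfcard_geP: cS => [->|[f]]; first by rewrite bigcup_set0.
have -> : \bigcup_(s in S) [set z : borel X * borel X | mdist s (z.1 : X) + mdist s (z.2 : X) < c] =
    \bigcup_n [set z : borel X * borel X | mdist (f n) (z.1 : X) + mdist (f n) (z.2 : X) < c].
  apply/seteqP; split => [z [s Ss zs]|z [n _ zn]].
    by have [n _ fns] := 'surj_f Ss; exists n => //; rewrite fns.
  by exists (f n) => //; exact: funS.
by apply: bigcupT_measurable => n; exact: mF.
Qed.

End Cost.

(** * The HWI inequality *)

Section HWI.
Context {R : realType} {X : completeMetricType R}.
Variable D : R.
Hypothesis XD : forall x y : X, mdist x y <= D.
Hypothesis Xsep : exists2 S : set X, countable S & dense S.
Implicit Types (mu nu : probability (borel X) R).

Lemma bmeas_mdist : bmeas (fun z : borel X * borel X => mdist (z.1 : X) z.2).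
Proof.
split; first exact: measurable_mdist.
by exists D => z; rewrite ger0_norm ?mdist_ge0.
Qed.

Lemma P2_bounded mu : P2 mu.
Proof.
exists point; have bd : bmeas (fun x : borel X => mdist (x : X) point ^+ 2).
  apply: bmeasX; split; last by exists D => x; rewrite ger0_norm ?mdist_ge0.
  under eq_fun do rewrite metric_sym.
  exact: lip_measurable (lip_mdist _).
by rewrite (bintE _ bd) ltry.
Qed.

Lemma coupling_fst (p : probability (borel X * borel X)%type R) mu nu
  (f : borel X -> R) : couplings mu nu p -> bmeas f ->
  \int[p]_z f z.1 = \int[mu]_x f x.
Proof.
move=> pc bf; congr fine.
transitivity (\int[pushforward p fst]_x (f x)%:E)%E.
  rewrite integral_pushforward//.
  - by apply/measurable_EFinP; case: bf.
  - apply: (bmeas_integrable p (f := f \o fst)).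
    case: bf => mf [M fM]; split; last by exists M => z; exact: fM.
    exact: measurableT_comp.
apply: eq_measure_integral => A mA _; rewrite /pushforward.
have [h _] := pc _ mA; apply: etrans h; congr (p _).
by apply/seteqP; split => [z|z []].
Qed.

Lemma coupling_snd (p : probability (borel X * borel X)%type R) mu nu
  (f : borel X -> R) : couplings mu nu p -> bmeas f ->
  \int[p]_z f z.2 = \int[nu]_x f x.
Proof.
move=> pc bf; congr fine.
transitivity (\int[pushforward p snd]_x (f x)%:E)%E.
  rewrite integral_pushforward//.
  - by apply/measurable_EFinP; case: bf.
  - apply: (bmeas_integrable p (f := f \o snd)).
    case: bf => mf [M fM]; split; last by exists M => z; exact: fM.
    exact: measurableT_comp.
apply: eq_measure_integral => A mA _; rewrite /pushforward.
have [_ h] := pc _ mA; apply: etrans h; congr (p _).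
by apply/seteqP; split => [z|z []].
Qed.

Lemma bmeas_fst (f : borel X -> R) : bmeas f ->
  bmeas (fun z : borel X * borel X => f z.1).
Proof.
by case=> mf [M fM]; split; [exact: measurableT_comp|exists M => z].
Qed.

Lemma bmeas_snd (f : borel X -> R) : bmeas f ->
  bmeas (fun z : borel X * borel X => f z.2).
Proof.
by case=> mf [M fM]; split; [exact: measurableT_comp|exists M => z].
Qed.

(** First variation: moving mu0 by a plan of quadratic cost at most c changes
    the integral of g by at most the L2 norm of its local Lipschitz constant
    times the square root of c, up to an error quadratic in the displacement,
    caused by pairs at distance more than r; the arithmetic-geometric mean
    inequality with weight k stands in for Cauchy-Schwarz. *)
Lemma transport_variation (p : probability (borel X * borel X)%type R) mu nu
  (g : X -> R) L r k : couplings mu nu p ->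
  0 <= L -> (forall x y, `|g x - g y| <= L * mdist x y) -> 0 < r -> 0 < k ->
  \int[mu]_x g x - \int[nu]_x g x <=
  k / 2 * \int[mu]_x (local_lip g r x ^+ 2) +
  (1 / (2 * k) + L / r) * \int[p]_z (mdist (z.1 : X) z.2 ^+ 2).
Proof.
move=> pc L0 gL r0 k0; have gl : lip g by exists L.
have bg : bmeas (g : borel X -> R).
  by split; [exact: lip_measurable|exact: lip_bounded XD gl].
have bl := bmeasX 2 (bmeas_local_lip gl r0).
have bd := bmeasX 2 bmeas_mdist.
rewrite -(coupling_fst pc bg) -(coupling_snd pc bg) -(coupling_fst pc bl).
rewrite -bintB; [|exact: bmeas_fst|exact: bmeas_snd].
rewrite -!bintZ//; last exact: (bmeas_fst bl).
rewrite -bintD; [|exact/bmeasZ/(bmeas_fst bl)|exact: bmeasZ].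
apply: bint_le.
- by apply: bmeasB; [exact: bmeas_fst|exact: bmeas_snd].
- by apply: bmeasD; [exact/bmeasZ/(bmeas_fst bl)|exact: bmeasZ].
move=> [x y] /=; set d := mdist _ _; set G := local_lip g r x.
have d0 : 0 <= d by exact: mdist_ge0.
have h0 : 0 <= 1 / (2 * k) * d ^+ 2 by rewrite mulr_ge0 ?sqr_ge0// divr_ge0// mulr_ge0// ltW.
have h1 : 0 <= L / r * d ^+ 2 by rewrite mulr_ge0 ?sqr_ge0// divr_ge0// ltW.
have h2 : 0 <= k / 2 * G ^+ 2 by rewrite mulr_ge0 ?sqr_ge0// divr_ge0// ltW.
have [dr|rd] := ltP d r.
  have : g x - g y <= G * d.
    by rewrite (le_trans (ler_norm _))// distrC; exact: (local_lip_ge L0 gL).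
  have : 0 <= (k * G - d) ^+ 2 / (2 * k) by rewrite divr_ge0 ?sqr_ge0// mulr_ge0// ltW.
  have -> : (k * G - d) ^+ 2 / (2 * k) = k / 2 * G ^+ 2 - G * d + 1 / (2 * k) * d ^+ 2.
    by field; rewrite gt_eqF.
  lra.
have : g x - g y <= L * d by rewrite (le_trans (ler_norm _)).
have : L * d <= L / r * d ^+ 2.
  have -> : L / r * d ^+ 2 = L * d * (d / r) by rewrite expr2; ring.
  by rewrite ler_peMr ?mulr_ge0// ler_pdivlMr// mul1r.
lra.
Qed.

Variables (m : {finite_measure set (borel X) -> \bar R}) (K : R).
Hypothesis cd : CD_infty m K.

Lemma cvg_int_local_lip mu (g : X -> R) : lip g ->
  \int[mu]_x (local_lip g n.+1%:R^-1 x ^+ 2) @[n --> \oo] --> \int[mu]_x (rslope g x ^+ 2).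
Proof.
move=> gl; case: (gl) => L L0 gL; apply: fine_cvg.
rewrite fineK; last by rewrite bintE//; exact/bmeasX/bmeas_rslope.
apply: (@dominated_cvg _ _ _ mu setT measurableT _ _ (EFin \o cst (L ^+ 2))) => //.
- move=> n; apply/measurable_EFinP; case: (bmeasX 2 (bmeas_local_lip gl (_ : 0 < n.+1%:R^-1))) => //.
- move=> x _; apply: cvg_EFin; first by near=> n.
  have h := cvg_local_lip L0 gL (x := x); exact: (cvgM h h).
- exact: finite_measure_integrable_cst.
- move=> n x _ /=; rewrite lee_fin ger0_norm ?sqr_ge0//.
  by rewrite lerXn2r ?nnegrE ?(local_lip_ge0 L0 gL) ?(local_lip_leL L0 gL).
Unshelve. all: end_near. Qed.

(** Along a geodesic issued from mu0 = exp(g) m the entropy stays above the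
    linear functional mu |-> int g dmu, with equality at mu0; hence its right
    derivative at mu0 is at least that of int g, which transport_variation
    bounds, while the convexity of the entropy bounds it from above. *)
Lemma HWI mu0 mu1 (g : X -> R) (E1 c kappa k : R) :
  lip g -> density m mu0 (fun x => expR (g x)) ->
  Ent m mu1 = E1%:E -> 0 < k -> 0 <= kappa -> - K <= kappa ->
  (ereal_inf [set \int[p]_z ((mdist (z.1 : X) z.2) ^+ 2)%:E | p in couplings mu0 mu1]
     < c%:E)%E ->
  \int[mu0]_x g x - E1 <=
  k / 2 * \int[mu0]_x (rslope g x ^+ 2) + c / (2 * k) + kappa / 2 * c.
Proof.
move=> gl dmu0 Emu1 k0 kap0 Kkap cc; case: (gl) => L L0 gL.
have bg : bmeas (g : borel X -> R).
  by split; [exact: lip_measurable|exact: lip_bounded XD gl].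
have beg : bmeas (fun x : borel X => expR (g x)).
  case: bg => mg [M gM]; split; first exact: measurableT_comp.
  exists (expR M) => x; rewrite ger0_norm ?expR_ge0// ler_expR.
  by rewrite (le_trans _ (gM x))// ler_norm.
have ieg1 : \int[m]_x expR (g x) = 1.
  rewrite /Rintegral; case: (dmu0) => _ _ <- //.
  by rewrite probability_setT.
have Emu0 : Ent m mu0 = (\int[mu0]_x g x)%:E.
  rewrite (Ent_density dmu0 beg) (density_int dmu0 bg); congr EFin.
  by apply: eq_Rintegral => x _; rewrite expRK mulrC.
set E0 := \int[mu0]_x g x in Emu0 *.
have DE0 : DEnt m mu0 by split; [exact: P2_bounded|rewrite Emu0].
have DE1 : DEnt m mu1 by split; [exact: P2_bounded|rewrite Emu1].
have [gam [gam0 gam1 _ gamW] gamE] := cd DE0 DE1.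
set C := ereal_inf _ in cc.
have C0 : (0 <= C)%E.
  by apply: le_ereal_inf_tmp => _ [p _ <-]; apply: integral_ge0 => z _; rewrite lee_fin sqr_ge0.
have W2C : (W2 mu0 mu1 ^+ 2 = C)%E by rewrite sqr_sqrte.
have Cfin : C \is a fin_num by rewrite ge0_fin_numE// (lt_trans cc)// ltry.
pose c' := fine C; have CE : C = c'%:E by rewrite fineK.
have c'0 : 0 <= c' by exact: fine_ge0.
have c'c : c' < c by rewrite -lte_fin -CE.
have step r t : 0 < r -> 0 < t -> t <= 1 ->
    E0 - E1 <= k / 2 * \int[mu0]_x (local_lip g r x ^+ 2) + (1 / (2 * k) + t * (L / r)) * c + kappa / 2 * c.
  move=> r0 t0 t1; have tI : t \in `[0, 1] by rewrite in_itv/= ltW.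
  have zI : (0:R) \in `[0, 1] by rewrite in_itv/= lexx ler01.
  (* a nearly optimal plan between mu0 and gam t *)
  have [p pc pt] : exists2 p, couplings mu0 (gam t) p &
      \int[p]_z (mdist (z.1 : X) z.2 ^+ 2) <= t ^+ 2 * c.
    have := gamW 0 t zI tI; rewrite gam0 sub0r normrN gtr0_norm// => W.
    have : (W2 mu0 (gam t) ^+ 2 < (t ^+ 2 * c)%:E)%E.
      rewrite W expe2 muleACA -[(W2 mu0 mu1 * _)%E]expe2 W2C CE -!EFinM -expr2 lte_fin ltr_pM2l//.
      exact: exprn_gt0.
    rewrite sqr_sqrte; last first.
      by apply: le_ereal_inf_tmp => _ [p _ <-]; apply: integral_ge0 => z _; rewrite lee_fin sqr_ge0.
    move=> /ereal_inf_lt[_ [p pc <-]] pt; exists p => //.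
    by rewrite -lee_fin -bintE ?ltW//; exact/bmeasX/bmeas_mdist.
  have := transport_variation pc L0 gL r0 (mulr_gt0 t0 k0).
  rewrite -/E0; set G := \int[gam t]_x g x; set A := \int[mu0]_x _ => var.
  have GE : (G%:E <= Ent m (gam t))%E by apply: Ent_lower; rewrite ?ieg1.
  have := le_trans GE (gamE t tI); rewrite Emu0 Emu1 W2C CE -!EFinM -!EFinD lee_fin => conv.
  have h1 : (1 / (2 * (t * k)) + L / r) * \int[p]_z (mdist (z.1 : X) z.2 ^+ 2) <=
      (1 / (2 * (t * k)) + L / r) * (t ^+ 2 * c).
    rewrite ler_wpM2l// addr_ge0// divr_ge0// ?ltW//.
    by rewrite !mulr_gt0.
  have h2 : - (K / 2 * t * (1 - t) * c') <= t * (kappa / 2 * c).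
    have -> : - (K / 2 * t * (1 - t) * c') = t / 2 * ((1 - t) * (- K * c')) by field.
    have -> : t * (kappa / 2 * c) = t / 2 * (kappa * c) by field.
    apply: ler_wpM2l; first by rewrite divr_ge0// ltW.
    apply: (@le_trans _ _ ((1 - t) * (kappa * c))).
      rewrite ler_wpM2l ?subr_ge0// (@le_trans _ _ (kappa * c'))//.
        by rewrite ler_wpM2r.
      by rewrite ler_wpM2l// ltW.
    have c0 : 0 <= c by rewrite (le_trans c'0)// ltW.
    by rewrite ler_piMl ?mulr_ge0// gerBl ltW.
  rewrite -(ler_pM2l t0).
  have -> : t * (k / 2 * A + (1 / (2 * k) + t * (L / r)) * c + kappa / 2 * c) =
      t * k / 2 * A + (1 / (2 * (t * k)) + L / r) * (t ^+ 2 * c) + t * (kappa / 2 * c).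
    by field; rewrite !gt_eqF.
  lra.
have step0 r : 0 < r ->
    E0 - E1 <= k / 2 * \int[mu0]_x (local_lip g r x ^+ 2) + c / (2 * k) + kappa / 2 * c.
  move=> r0; apply/ler_addgt0Pr => e e0.
  have c0 : 0 < c by rewrite (le_lt_trans c'0).
  pose M := L / r * c + 1; have M0 : 0 < M.
    by rewrite ltr_wpDl// mulr_ge0 ?divr_ge0// ltW.
  have := @step r (Num.min 1 (e / M)) r0; rewrite lt_min ltr01 divr_gt0// ge_min lexx.
  move=> /(_ isT isT); set t := Num.min _ _ => h.
  have t0 : 0 <= t by rewrite le_min ler01 divr_ge0// ltW.
  have : t * M <= e by rewrite -ler_pdivlMr// ge_min lexx orbT.
  have hE : (1 / (2 * k) + t * (L / r)) * c = c / (2 * k) + t * (L / r * c).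
    by rewrite mulrDl mul1r [_^-1 * _]mulrC !mulrA.
  rewrite hE in h; rewrite /M mulrDr mulr1; lra.
have cv : k / 2 * \int[mu0]_x (local_lip g n.+1%:R^-1 x ^+ 2) @[n --> \oo] -->
    k / 2 * \int[mu0]_x (rslope g x ^+ 2).
  by apply: cvgM; [exact: cvg_cst|exact: cvg_int_local_lip].
rewrite -addrA -lerBlDr -(cvg_lim _ cv)//.
apply: limr_ge; first exact: cvgP cv.
by near=> n; rewrite lerBlDr addrA; apply: step0.
Unshelve. all: end_near. Qed.

End HWI.

(** * An entropy-energy inequality for functions vanishing on half of the space *)

Lemma mnormalize_mass1 {d} {T : measurableType d} {R : realType}
  (mu : {measure set T -> \bar R}) (P : probability T R) A :
  mu setT = 1%E -> mnormalize mu P A = mu A.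
Proof. by move=> mu1; rewrite /mnormalize mu1 onee_eq0 /= invr1 mule1. Qed.

Section Mixtures.
Context {R : realType} {X : completeMetricType R}.

Lemma density_exists (m : {finite_measure set (borel X) -> \bar R})
  (rho : X -> R) : bmeas (rho : borel X -> R) -> (forall x, 0 <= rho x) ->
  \int[m]_x rho x = 1 -> exists mu : probability (borel X) R, density m mu rho.
Proof.
move=> br r0 ir1; case: (br) => mr _.
pose nu (A : set (borel X)) := (\int[m]_(x in A) (rho x)%:E)%E.
have nu0 : nu set0 = 0%E by exact: integral_set0.
have nuge0 A : (0 <= nu A)%E by apply: integral_ge0 => x _; rewrite lee_fin.
have nuadd : semi_sigma_additive nu.
  move=> F mF tF mUF; rewrite /nu ge0_integral_bigcup//.
  - apply: is_cvg_nneseries => n _ _; exact: nuge0.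
  - by apply/measurable_EFinP; exact: measurable_funTS.
  - by move=> x _; rewrite lee_fin.
pose nuM : {measure set (borel X) -> \bar R} :=
  HB.pack nu (isMeasure.Build _ _ _ nu nu0 nuge0 nuadd).
have nu1 : nuM setT = 1%E by rewrite /= /nu bintE// ir1.
exists (mnormalize nuM (dirac point)); split => // A mA.
exact: mnormalize_mass1.
Qed.

Variable D : R.
Hypothesis XD : forall x y : X, mdist x y <= D.
Hypothesis Xsep : exists2 S : set X, countable S & dense S.

(** Only the fraction a of the mass has to travel, over a distance at most D. *)
Lemma cost_mixture (mu0 mu1 nu : probability (borel X) R) (a : R) :
  0 <= a <= 1 ->
  (forall A : set (borel X), measurable A ->
     mu1 A = (1 - a)%:E * mu0 A + a%:E * nu A)%E ->
  (ereal_inf [set \int[p]_z ((mdist (z.1 : X) z.2) ^+ 2)%:E | p in couplings mu0 mu1]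
     <= (a * D ^+ 2)%:E)%E.
Proof.
move=> /andP[a0 a1] mu1E; have b0 : 0 <= 1 - a by rewrite subr_ge0.
pose diag (x : borel X) : borel X * borel X := (x, x).
have mdiag : measurable_fun setT diag by exact: measurable_fun_pair.
pose diagP : {measure set (borel X * borel X) -> \bar R} :=
  Measure.clone _ _ _ (pushforward mu0 diag) _.
pose q := measure_add (mscale (NngNum b0) (diagP mdiag)) (mscale (NngNum a0) (mu0 \x nu)%E).
have qE A : q A = ((1 - a)%:E * mu0 (diag @^-1` A) + a%:E * (mu0 \x nu)%E A)%E.
  by rewrite /q measure_addE.
have q1 : q setT = 1%E.
  rewrite qE preimage_setT !probability_setT !mule1 -EFinD.
  by rewrite subrK.
pose p : probability (borel X * borel X)%type R := mnormalize q (dirac point).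
have pE A : p A = q A by exact: mnormalize_mass1.
apply: ereal_inf_le; exists (\int[p]_z ((mdist (z.1 : X) z.2) ^+ 2)%:E)%E.
  exists p => // A mA; split; rewrite pE qE.
    rewrite product_measure1E// [X in (_ * (_ * X))%E](probability_setT nu) mule1.
    rewrite (_ : diag @^-1` _ = A); last by apply/seteqP; split => [x []|x].
    rewrite -ge0_muleDl ?lee_fin// -EFinD subrK mul1e//.
  rewrite product_measure1E// [X in (_ * (X * _))%E](probability_setT mu0) mul1e mu1E//.
  by rewrite (_ : diag @^-1` _ = A)//; apply/seteqP; split => [x []|x].
have bd : bmeas (fun z : borel X * borel X => mdist (z.1 : X) z.2 ^+ 2).
  by apply: bmeasX; exact: (bmeas_mdist XD Xsep).
have md : measurable_fun setT (fun z : borel X * borel X => (mdist (z.1 : X) z.2 ^+ 2)%:E).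
  by apply/measurable_EFinP; case: bd.
have d0 z : (0 <= (mdist (z.1 : X) (z.2 : X) ^+ 2)%:E)%E by rewrite lee_fin sqr_ge0.
rewrite (eq_measure_integral q); last by move=> A _ _; exact: pE.
rewrite ge0_integral_measure_add// !ge0_integral_mscale//.
rewrite (ge0_integral_pushforward mdiag)// preimage_setT.
rewrite integral0_eq ?mule0 ?add0e; last first.
  by move=> x _ /=; rewrite mdistxx expr0n.
rewrite EFinM lee_pmul//; first by exact: integral_ge0.
apply: (@le_trans _ _ (\int[(mu0 \x nu)%E]_z (D ^+ 2)%:E)%E).
  apply: ge0_le_integral => // z _; rewrite lee_fin lerXn2r ?nnegrE ?mdist_ge0//.
  by rewrite (le_trans _ (XD z.1 z.2))// mdist_ge0.
by rewrite integral_cst// [X in (_ * X)%E](probability_setT (mu0 \x nu)%E) mule1.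
Qed.

End Mixtures.

Section XlnX.
Context {R : realType}.
Implicit Types (x y s t : R).
Local Notation G := (fun x : R => x * ln x).

Lemma xlnx_ge x : 0 <= x -> x - 1 <= G x.
Proof. by move=> x0; have := fenchel_xlnx 0 x0; rewrite mulr0 add0r expR0. Qed.

Lemma xlnxM x y : 0 <= x -> 0 < y -> G (y * x) = y * G x + x * G y.
Proof.
rewrite le_eqVlt => /predU1P[<-|x0] y0; first by rewrite !(mulr0, mul0r) addr0.
by rewrite /= lnM ?posrE//; ring.
Qed.

Lemma xlnx_superadditive x y : 0 <= x -> 0 < y -> G x + G y <= G (x + y).
Proof.
rewrite le_eqVlt => /predU1P[<-|x0] y0; first by rewrite mul0r !add0r.
rewrite /= mulrDl lerD// ler_pM2l// ler_ln ?posrE ?addr_gt0// ?lerDl ?lerDr ltW//.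
Qed.

(** Tangent line at the mixture itself, averaged over the two endpoints. *)
Lemma xlnx_convex x s : 0 <= x -> 0 < s -> s <= 1 ->
  G ((1 - s) * x + s) <= (1 - s) * G x.
Proof.
move=> x0 s0 s1; set r := (1 - s) * x + s.
have r0 : 0 < r by rewrite ltr_wpDl// mulr_ge0// subr_ge0.
have h1 := fenchel_xlnx (ln r) x0; have h2 := fenchel_xlnx (ln r) (@ler01 R).
rewrite lnK ?posrE// in h1 h2; rewrite ln1 mulr0 mul1r in h2.
have s1' : 0 <= 1 - s by rewrite subr_ge0.
have h3 := ler_wpM2l s1' h1; have h4 := ler_wpM2l (ltW s0) h2.
rewrite mulr0 in h4; rewrite /= -/r.
have : (1 - s) * (x * ln r + x - r) + s * (ln r + 1 - r) = r * ln r.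
  by rewrite /r; ring.
lra.
Qed.

Lemma ln_ge1BV x : 0 < x -> 1 - x^-1 <= ln x.
Proof.
move=> x0; have := @fenchel_xlnx R 1 (- ln x) ler01.
rewrite ln1 mulr0 expRN lnK ?posrE//; lra.
Qed.

(** Superadditivity isolates the term t ln t, so that nothing is lost near
    x = 0, where x ln x has infinite slope. *)
Lemma xlnx_mixture_ge x t : 0 <= x -> 0 < t -> t < 1 ->
  (1 - t) * G x - t * x + G t <= G ((1 - t) * x + t).
Proof.
move=> x0 t0 t1; have t1' : 0 < 1 - t by rewrite subr_gt0.
have := xlnx_superadditive (mulr_ge0 (ltW t1') x0) t0.
rewrite [G ((1 - t) * x)]xlnxM// => h.
have : - t <= G (1 - t).
  have := ln_ge1BV t1'; rewrite -(ler_pM2l t1') mulrBr mulr1 mulfV ?gt_eqF//=; lra.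
move=> /(ler_wpM2l x0); rewrite /= in h *; lra.
Qed.

End XlnX.

Lemma is_derive_lip {R : realType} (B : R -> R) (t0 b e : R) :
  is_derive t0 1 B b -> 0 < e ->
  exists2 s, 0 < s & forall t, `|t - t0| < s -> `|B t - B t0| <= (`|b| + e) * `|t - t0|.
Proof.
move=> [dB Bb] e0; have /cvgrPdist_lt/(_ _ e0) := dB.
rewrite [lim _]Bb => /nbhs_ballP[s /= s0 sB]; exists s => // t ts.
have [->|tt0] := eqVneq t t0; first by rewrite !subrr normr0 mulr0.
have nz : t - t0 != 0 by rewrite subr_eq0.
have /= := sB (t - t0); rewrite /ball/= sub0r normrN => /(_ ts nz).
have -> : (t - t0)%:A + t0 = t by rewrite /GRing.scale /= mulr1 subrK.
rewrite /GRing.scale /= => h.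
rewrite -ler_pdivrMr ?normr_gt0// -normf_div [X in `|X|]mulrC.
set q := _^-1 * _ in h *.
have -> : q = b - (b - q) by rewrite opprB addrC subrK.
by rewrite (le_trans (ler_normB _ _))// lerD2l ltW.
Qed.

Lemma is_derive_ln_mixture {R : realType} (t V t0 : R) : 0 < t -> t < 1 -> 0 < V ->
  is_derive t0 1 (fun x : R => ln (((1 - t) * x ^+ 2 + t) / V))
    (2 * (1 - t) * t0 / ((1 - t) * t0 ^+ 2 + t)).
Proof.
move=> t_gt0 t1 V0; set q := (1 - t) * t0 ^+ 2 + t.
have q0 : 0 < q by rewrite ltr_wpDl// mulr_ge0 ?sqr_ge0// subr_ge0 ltW.
have d1 : is_derive t0 1 (fun x : R => ((1 - t) * x ^+ 2 + t) / V) (2 * (1 - t) * t0 / V).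
  by apply: is_derive_eq; rewrite /GRing.scale /=; ring.
have d2 : is_derive (q / V) 1 (@ln R) (q / V)^-1.
  by apply: is_derive1_ln; rewrite divr_gt0.
have := @is_derive1_comp R (@ln R) (fun x : R => ((1 - t) * x ^+ 2 + t) / V) t0 _ _ d2 d1.
move=> h; apply: (is_derive_eq h); rewrite /q in q0 *; field.
by rewrite !gt_eqF.
Qed.

Lemma ln_lip {R : realType} (t a b : R) : 0 < t -> t <= a -> t <= b ->
  `|ln a - ln b| <= `|a - b| / t.
Proof.
move=> t0; wlog ba : a b / b <= a.
  move=> W ta tb; case: (leP b a) => [|/ltW] ab; first exact: W.
  by rewrite distrC (distrC a); exact: W.
move=> ta tb; have a0 := lt_le_trans t0 ta; have b0 := lt_le_trans t0 tb.
rewrite !ger0_norm ?subr_ge0// ?ler_ln ?posrE//.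
have := ln_ge1BV (divr_gt0 b0 a0); rewrite ln_div ?posrE// invf_div => h.
apply: (@le_trans _ _ ((a - b) / b)); last first.
  by rewrite ler_wpM2l ?subr_ge0// lef_pV2 ?posrE.
rewrite mulrBl divff ?gt_eqF//; lra.
Qed.

Section EntropyEnergy.
Context {R : realType} {X : completeMetricType R}.
Variable D : R.
Hypothesis D0 : 0 < D.
Hypothesis XD : forall x y : X, mdist x y <= D.
Hypothesis Xsep : exists2 S : set X, countable S & dense S.
Variables (m : {finite_measure set (borel X) -> \bar R}) (K kappa : R).
Hypothesis cd : CD_infty m K.
Hypotheses (kappa0 : 0 <= kappa) (Kkappa : - K <= kappa).
Local Notation V := (fine (m setT)).
Hypothesis V0 : 0 < V.

Lemma lip_bmeas (u : X -> R) : lip u -> bmeas (u : borel X -> R).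
Proof. by move=> ul; split; [exact: lip_measurable|exact: lip_bounded XD ul]. Qed.

Lemma entropy_normalize (rho : borel X -> R) : bmeas rho -> (forall x, 0 < rho x) ->
  \int[m]_x rho x = V ->
  \int[m]_x (rho x / V * ln (rho x / V)) = (\int[m]_x (rho x * ln (rho x))) / V - ln V.
Proof.
move=> br r0 irV; have bx := bmeas_xlnx br (fun x => ltW (r0 x)).
transitivity (\int[m]_x (V^-1 * (rho x * ln (rho x)) - ln V / V * rho x)).
  by apply: eq_Rintegral => x _; rewrite ln_div ?posrE//; ring.
rewrite bintB; [|exact: bmeasZ..].
by rewrite !bintZ// irV divfK ?gt_eqF// mulrC.
Qed.

(** Interpolate between the probability densities (1-t) u^2 + t and
    (1-s) u^2 + s with respect to the normalised measure, for t much smaller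
    than s: a portion at most s of the mass has to be moved, so W2^2 <= s D^2,
    whereas filling the region {u = 0} lowers the entropy by s ln (1/s) / 2.
    The latter beats the defect kappa s D^2 / 2 of convexity once s is small.
    The first density, being positive, has a Lipschitz logarithm. *)
Lemma entropy_energy (u : X -> R) : lip u -> (forall x, 0 <= u x) ->
  (m [set x | (0 < u x)%R] <= 2^-1%:E * m setT)%E ->
  \int[m]_x (u x ^+ 2) = V ->
  let e := (\int[m]_x (u x ^+ 2 * ln (u x ^+ 2))) / V in
  0 <= e /\ expR (- (2 * kappa * D ^+ 2 + 9)) * (e + 1) ^+ 2 <=
            16 * D ^+ 2 * ((\int[m]_x (rslope u x ^+ 2)) / V).
Proof.
move=> ul u0 uhalf uV e; set ell := 2 * kappa * D ^+ 2 + 9; set s := expR (- ell).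
set P := \int[m]_x (rslope u x ^+ 2); pose t := s ^+ 2.
have D20 : 0 < D ^+ 2 by exact: exprn_gt0.
have ell9 : 9 <= ell by rewrite lerDr !mulr_ge0// ltW.
have s0 : 0 < s by exact: expR_gt0.
have s10 : s <= 1 / 10.
  rewrite /s expRN mul1r lef_pV2 ?posrE ?expR_gt0//.
  by apply: le_trans (expR_ge1Dx _); lra.
have t0 : 0 < t by exact: exprn_gt0.
have ts : t < s by rewrite /t expr2 gtr_pMl//; lra.
have t1 : t < 1 by lra.
have s1 : s < 1 by lra.
have bu := lip_bmeas ul; have bu2 := bmeasX 2 bu.
pose y (x : X) := u x ^+ 2; have y0 x : 0 <= y x by exact: sqr_ge0.
have byx := bmeas_xlnx bu2 y0; have bsl := bmeas_rslope ul; have bsl2 := bmeasX 2 bsl.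
have Vn0 : V != 0 by rewrite gt_eqF.
have bc c : bmeas (fun x : borel X => c : R) by exact: bmeas_cst.
have eV : \int[m]_x (y x * ln (y x)) = e * V by rewrite /e divfK.
have e0 : 0 <= e.
  apply: divr_ge0; last exact: ltW.
  apply: (@le_trans _ _ (\int[m]_x (y x - 1))).
    by rewrite bintB// uV (bint_cst m 1) mul1r subrr.
  apply: bint_le => //; first exact: bmeasB.
  by move=> x; exact: xlnx_ge.
split => //.
(* kept undivided by V, so that the pointwise inequalities for x ln x apply *)
pose rho a (x : X) : R := (1 - a) * y x + a.
have brho a : bmeas (rho a : borel X -> R) by apply: bmeasD => //; exact: bmeasZ.
have rho_gea a x : a <= 1 -> a <= rho a x.
  by move=> a1; rewrite lerDr mulr_ge0// subr_ge0.
have irho a : \int[m]_x rho a x = V.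
  rewrite bintD//; last exact: bmeasZ.
  by rewrite bintZ// uV (bint_cst m a); ring.
have rt0 x : 0 < rho t x by rewrite (lt_le_trans t0)// rho_gea// ltW.
have rs0 x : 0 < rho s x by rewrite (lt_le_trans s0)// rho_gea// ltW.
pose g (x : X) := ln (rho t x / V).
have egE x : expR (g x) = rho t x / V by rewrite lnK// posrE divr_gt0.
have bV a : bmeas (fun x : borel X => rho a x / V) by apply: bmeasM.
have iV a : \int[m]_x (rho a x / V) = 1.
  under eq_Rintegral do rewrite mulrC.
  by rewrite bintZ// irho mulVf.
have [mu0 dmu0] : exists mu0, density m mu0 (fun x => rho t x / V).
  by apply: density_exists => // x; rewrite divr_ge0// ltW.
have [mu1 dmu1] : exists mu1, density m mu1 (fun x => rho s x / V).
  by apply: density_exists => // x; rewrite divr_ge0// ltW.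
have [nu dnu] : exists nu, density m nu (fun=> V^-1).
  apply: density_exists => //; first by move=> _; rewrite invr_ge0 ltW.
  by rewrite (bint_cst m V^-1) mulVf.
pose a := (s - t) / (1 - t).
have t1' : 0 < 1 - t by rewrite subr_gt0.
have a0 : 0 <= a by rewrite divr_ge0// ?subr_ge0 ltW.
have as_ : a < s by rewrite ltr_pdivrMr//; nra.
have cost : (ereal_inf [set \int[p]_z ((mdist (z.1 : X) z.2) ^+ 2)%:E | p in couplings mu0 mu1]
     < (s * D ^+ 2)%:E)%E.
  apply: (@le_lt_trans _ _ (a * D ^+ 2)%:E); last by rewrite lte_fin ltr_pM2r.
  apply: (cost_mixture XD Xsep (nu := nu)); first by rewrite a0 ltW// (lt_trans as_).
  move=> A mA; case: dmu0 => _ r0 ->//; case: dmu1 => _ _ ->//; case: dnu => _ _ ->//.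
  have a1 : 0 <= 1 - a by rewrite subr_ge0 ltW// (lt_trans as_).
  have mV b : measurable_fun A (fun x : borel X => (rho b x / V)%:E).
    by apply/measurable_EFinP; apply: measurable_funTS; case: (bV b).
  rewrite -!ge0_integralZl//; last 2 first.
  - by move=> x _; rewrite lee_fin invr_ge0 ltW.
  - by move=> x _; rewrite lee_fin.
  rewrite -ge0_integralD//.
  - apply: eq_integral => x _; rewrite -!EFinM -EFinD /rho /a; congr EFin.
    by field; rewrite Vn0 gt_eqF.
  - by move=> x _; rewrite mule_ge0// lee_fin.
  - by apply: measurable_funeM.
  - by move=> x _; rewrite mule_ge0// lee_fin ?invr_ge0 ltW.
have gl : lip g.
  case: (bu) => _ [M uM]; case: (ul) => L L0 uL.
  have M0 : 0 <= M by rewrite (le_trans _ (uM point)).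
  (* the density is at least t and u is bounded by M with Lipschitz constant L *)
  exists (2 * M * L / t).
    by rewrite !mulr_ge0// invr_ge0 ltW.
  move=> x x'; rewrite /g !ln_div ?posrE// opprB addrA subrK.
  apply: (le_trans (ln_lip t0 _ _)); try by apply: rho_gea; exact: ltW.
  rewrite [leRHS]mulrAC ler_pM2r ?invr_gt0//.
  have -> : rho t x - rho t x' = (1 - t) * ((u x + u x') * (u x - u x')).
    by rewrite /rho /y; ring.
  rewrite normrM (gtr0_norm t1').
  apply: (@le_trans _ _ `|(u x + u x') * (u x - u x')|).
    by rewrite ler_piMl// gerBl ltW.
  rewrite normrM -[leRHS]mulrA ler_pM//.
  by rewrite (le_trans (ler_normD _ _))// mulr_natl mulr2n lerD.
have slg x : rslope g x ^+ 2 * (rho t x / V) <= 4 / V * rslope u x ^+ 2.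
  set q := rho t x; have q0 : 0 < q by exact: rt0.
  pose b := 2 * (1 - t) * u x / q.
  have b0 : 0 <= b by rewrite divr_ge0 ?(ltW q0)// !mulr_ge0// ltW.
  have slb : rslope g x <= b * rslope u x.
    apply: (@slope_comp _ _ (fun z => ln (((1 - t) * z ^+ 2 + t) / V))) => // d d0.
    have [r r0 rB] := is_derive_lip (is_derive_ln_mixture (u x) t0 t1 V0) d0.
    by exists r => // z /rB; rewrite -/b (ger0_norm b0).
  have h1 : rslope g x ^+ 2 <= b ^+ 2 * rslope u x ^+ 2.
    by rewrite -exprMn lerXn2r// nnegrE; [exact: rslope_ge0|exact: mulr_ge0 (rslope_ge0 _ _)].
  apply: (@le_trans _ _ (b ^+ 2 * rslope u x ^+ 2 * (q / V))).
    by rewrite ler_wpM2r// divr_ge0// ltW.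
  have -> : b ^+ 2 * rslope u x ^+ 2 * (q / V) =
      (4 / V * rslope u x ^+ 2) * ((1 - t) * ((1 - t) * y x / q)).
    by rewrite /b /y; field; rewrite Vn0 gt_eqF.
  rewrite ler_piMr//; first by rewrite mulr_ge0 ?sqr_ge0// divr_ge0// ltW.
  have w0 : 0 <= (1 - t) * y x by rewrite mulr_ge0// ltW.
  have w1 : (1 - t) * y x / q <= 1 by rewrite ler_pdivrMr// mul1r lerDl ltW.
  rewrite mulr_ile1//; [exact: ltW|by rewrite divr_ge0// ltW|by rewrite gerBl ltW].
have HW k : 0 < k -> s * (e / 2 + 2) <= 2 * k * (P / V) + s * D ^+ 2 / (2 * k).
  move=> k0.
  have dmu0g : density m mu0 (fun x => expR (g x)).
    by rewrite (_ : (fun x => _) = fun x => rho t x / V)//; apply/funext => x.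
  have := HWI XD Xsep cd gl dmu0g (Ent_density dmu1 (bV s)) k0 kappa0 Kkappa cost.
  have bg := lip_bmeas gl.
  rewrite (density_int dmu0 bg) (density_int dmu0 (bmeasX 2 (bmeas_rslope gl))).
  have -> : \int[m]_x (g x * (rho t x / V)) = \int[m]_x (rho t x / V * ln (rho t x / V)).
    by apply: eq_Rintegral => x _; rewrite mulrC.
  rewrite !entropy_normalize//.
  have h1 : \int[m]_x (rslope g x ^+ 2 * (rho t x / V)) <= 4 / V * P.
    rewrite -bintZ//; apply: bint_le => //; last exact: bmeasZ.
    by apply: bmeasM => //; apply: bmeasX; exact: bmeas_rslope.
  have h2 : (1 - t) * e * V - t * V + t * ln t * V <= \int[m]_x (rho t x * ln (rho t x)).
    have <- : \int[m]_x ((1 - t) * (y x * ln (y x)) - t * y x + t * ln t) =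
        (1 - t) * e * V - t * V + t * ln t * V.
      rewrite bintD//; last by apply: bmeasB; exact: bmeasZ.
      rewrite bintB; [|exact: bmeasZ..].
      by rewrite (bint_cst m (t * ln t)) !bintZ// eV uV; ring.
    apply: bint_le.
    - by apply: bmeasD => //; apply: bmeasB; exact: bmeasZ.
    - by apply: bmeas_xlnx => // x; exact: ltW.
    - by move=> x; exact: xlnx_mixture_ge.
  pose Z : set (borel X) := [set x | (0 < u x)%R].
  have mZ : measurable Z by apply: sub_sigma_algebra; exact: lip_open.
  have Zhalf : fine (m Z) <= V / 2.
    rewrite -lee_fin fineK ?fin_num_measure// mulrC EFinM fineK ?fin_num_measure//.
  have h3 : \int[m]_x (rho s x * ln (rho s x)) <= (1 - s) * e * V + s * ln s * (V / 2).
    have slns : s * ln s <= 0 by rewrite mulr_ge0_le0 ?ltW// ln_lt0// s0 s1.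
    have : \int[m]_x ((1 - s) * (y x * ln (y x)) + (s * ln s * 1 - s * ln s * \1_Z x)) =
        (1 - s) * e * V + s * ln s * (V - fine (m Z)).
      have bZ := @bmeas_indic _ _ R _ mZ.
      rewrite bintD; [|exact: bmeasZ|by apply: bmeasB => //; exact: bmeasZ].
      rewrite bintB//; last exact: bmeasZ.
      by rewrite (bint_cst m (s * ln s * 1)) !bintZ// bint_indic// eV; ring.
    move=> h; apply: (@le_trans _ _ ((1 - s) * e * V + s * ln s * (V - fine (m Z)))).
      rewrite -h; apply: bint_le.
      - by apply: bmeas_xlnx => // x; exact: ltW.
      - apply: bmeasD; first exact: bmeasZ.
        by apply: bmeasB => //; apply/bmeasZ/bmeas_indic.
      - move=> x; rewrite indicE; case: (boolP (x \in Z)) => [_|xZ] /=.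
          by rewrite mulr1 subrr addr0; apply: xlnx_convex => //; exact: ltW.
        have ux : u x = 0.
          apply/eqP; rewrite eq_le u0 andbT leNgt; apply: contra xZ => ux.
          exact: mem_set.
        by rewrite /rho /y ux expr0n/= !(mulr0, mul0r, add0r, subr0, mulr1).
    rewrite lerD2l; apply: ler_wnM2l => //; lra.
  have lns : ln s = - ell by rewrite expRK.
  have lnt : ln t = - (2 * ell) by rewrite lnXn// lns; ring.
  have h2' : (1 - t) * e - t - 2 * t * ell <=
      (\int[m]_x (rho t x * ln (rho t x))) / V.
    by rewrite ler_pdivlMr//; rewrite lnt in h2; lra.
  have h3' : (\int[m]_x (rho s x * ln (rho s x))) / V <= (1 - s) * e - s * ell / 2.
    by rewrite ler_pdivrMr//; rewrite lns in h3; lra.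
  have h4 : k / 2 * \int[m]_x (rslope g x ^+ 2 * (rho t x / V)) <= 2 * k * (P / V).
    have -> : 2 * k * (P / V) = k / 2 * (4 / V * P) by field.
    by apply: ler_wpM2l => //; rewrite divr_ge0// ltW.
  have h5 : s * (e / 2 + 2) + kappa / 2 * (s * D ^+ 2) <=
      (1 - t) * e - t - 2 * t * ell - ((1 - s) * e - s * ell / 2).
    have -> : (1 - t) * e - t - 2 * t * ell - ((1 - s) * e - s * ell / 2) =
      s * ((1 - s) * e - s + ell / 2 - 2 * s * ell) by rewrite /t; field.
    have -> : s * (e / 2 + 2) + kappa / 2 * (s * D ^+ 2) =
      s * (e / 2 + 2 + (ell - 9) / 4) by rewrite /ell; field.
    rewrite ler_pM2l//.
    have : s * e <= 1 / 10 * e by rewrite ler_wpM2r.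
    have : s * ell <= 1 / 10 * ell by rewrite ler_wpM2r//; lra.
    lra.
  lra.
have e2 : 0 < e / 2 + 2 by lra.
(* the weight that makes the last term half of the left-hand side *)
have := HW (D ^+ 2 / (e / 2 + 2)); rewrite divr_gt0// => /(_ isT).
have algebra w : w != 0 -> s * D ^+ 2 / (2 * (D ^+ 2 / w)) = s * w / 2.
  by move=> wn0; field; rewrite wn0 gt_eqF.
rewrite algebra ?gt_eqF// => h.
have {}h : s * (e / 2 + 2) / 2 <= 2 * D ^+ 2 * (P / V) / (e / 2 + 2) by lra.
rewrite ler_pdivlMr// in h.
have : s * (e + 1) ^+ 2 <= s * (e + 4) ^+ 2.
  by rewrite ler_pM2l//; nra.
have -> : s * (e + 4) ^+ 2 = 8 * (s * (e / 2 + 2) / 2 * (e / 2 + 2)) by field.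
lra.
Qed.

End EntropyEnergy.

(** * The gap for functions vanishing on half of the space *)

(** With C = 16 D^2 / s the constant of entropy_energy, this is 1 / (288 C) up
    to the factor e^-4, the square of the loss in passing from the values of a
    function to the levels e^k below them. *)
Definition gap_constant {R : realType} (kappa D : R) : R :=
  expR (- 2) ^+ 2 / 288 * (expR (- (2 * kappa * D ^+ 2 + 9)) / (16 * D ^+ 2)).

Lemma gap_constant_gt0 {R : realType} (kappa D : R) : 0 < D -> 0 < gap_constant kappa D.
Proof.
move=> D0; apply: mulr_gt0; apply: divr_gt0.
- exact: exprn_gt0 (expR_gt0 _).
- by rewrite ltr0n.
- exact: expR_gt0.
- by apply: mulr_gt0; [rewrite ltr0n|exact: exprn_gt0].
Qed.

Section Gap.
Context {R : realType} {X : completeMetricType R}.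
Variable D : R.
Hypothesis D0 : 0 < D.
Hypothesis XD : forall x y : X, mdist x y <= D.
Hypothesis Xsep : exists2 S : set X, countable S & dense S.
Variables (m : {finite_measure set (borel X) -> \bar R}) (K kappa : R).
Hypothesis cd : CD_infty m K.
Hypotheses (kappa0 : 0 <= kappa) (Kkappa : - K <= kappa).
Local Notation V := (fine (m setT)).
Hypothesis V0 : 0 < V.

Definition half_supported (u : X -> R) :=
  [/\ lip u, forall x, 0 <= u x &
      (m [set x | (0 < u x)%R] <= 2^-1%:E * m setT)%E].

Local Notation H := (fine (cheeger_constant m)).

(** A single competitor with positive integral and bounded slope makes
    Cheeger's constant finite. *)
Lemma cheeger_fin_num (u : X -> R) : half_supported u ->
  0 < \int[m]_x (u x ^+ 2) -> cheeger_constant m \is a fin_num.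
Proof.
move=> [ul u0 uh] Q0; have bu := lip_bmeas XD ul; case: (bu) => _ [M uM].
have := cheeger_L1 ul (ex_intro _ M uM) u0 uh.
rewrite ge0_fin_numE ?cheeger_constant_ge0//.
case: (cheeger_constant m) (cheeger_constant_ge0 m) => [r _ _|_|//]; first exact: ltry.
have u_gt0 : 0 < \int[m]_x u x.
  have : \int[m]_x (u x ^+ 2) <= M * \int[m]_x u x.
    rewrite -bintZ//; apply: bint_le => //; [exact: bmeasX|exact: bmeasZ|].
    by move=> x; rewrite expr2 ler_wpM2r// (le_trans _ (uM x))// ler_norm.
  move=> /(lt_le_trans Q0); apply: contraTT; rewrite -!leNgt => ule.
  have : 0 <= \int[m]_x u x by exact: Rintegral_ge0.
  by move=> uge; rewrite (_ : \int[m]_x u x = 0) ?mulr0//; apply/eqP; rewrite eq_le ule.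
by rewrite gt0_mulye ?lte_fin.
Qed.

(** Cheeger's inequality applied to the square of the truncation of u at height
    sigma, whose slope lives where u does not exceed sigma. *)
Lemma cheeger_truncation (u : X -> R) sigma : half_supported u ->
  cheeger_constant m \is a fin_num -> 0 < sigma ->
  H * \int[m]_x (Num.min (u x) sigma ^+ 2) <=
  \int[m]_x (2 * u x * \1_[set x | u x <= sigma] x * rslope u x).
Proof.
move=> [ul u0 uh] hfin s0; have bu := lip_bmeas XD ul; case: (bu) => mu [M uM].
case: (ul) => L L0 uL.
pose B (z : R) := Num.min `|z| sigma ^+ 2.
have minL (z z' : R) : `|Num.min z sigma - Num.min z' sigma| <= `|z - z'|.
  wlog zz : z z' / z' <= z.
    move=> W; case: (leP z' z) => [/W//|/ltW/W].
    by rewrite distrC (distrC z).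
  have h : Num.min z' sigma <= Num.min z sigma.
    by rewrite le_min !ge_min zz lexx orbT.
  rewrite !ger0_norm ?subr_ge0//; rewrite /Num.min; do 2 case: ifP; lra.
have BM (z z' : R) : `|B z - B z'| <= (`|z| + `|z'|) * `|z - z'|.
  rewrite /B subr_sqr normrM mulrC ler_pM//.
    rewrite ger0_norm ?addr_ge0 ?le_min ?normr_ge0 ?(ltW s0)//.
    by rewrite lerD// ge_min lexx.
  by rewrite (le_trans (minL _ _))// ler_dist_dist.
have wl : lip (B \o u).
  have M0 : 0 <= M by rewrite (le_trans _ (uM point)).
  exists (2 * M * L); first by rewrite !mulr_ge0.
  move=> x y; rewrite (le_trans (BM _ _))// -mulrA ler_pM//.
  by rewrite mulr_natl mulr2n lerD.
have bw := lip_bmeas XD wl; case: (bw) => _ wb.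
have w0 x : 0 <= (B \o u) x by exact: sqr_ge0.
have wh : (m [set x | (0 < (B \o u) x)%R] <= 2^-1%:E * m setT)%E.
  apply: le_trans uh; apply: le_measure; rewrite ?inE.
  - by apply: sub_sigma_algebra; exact: lip_open.
  - by apply: sub_sigma_algebra; exact: lip_open.
  - move=> x /=; rewrite !lt0r u0 andbT => /andP[+ _]; apply: contra => /eqP ux.
    by rewrite /B ux normr0 (min_idPl (ltW s0)) expr0n.
have -> : \int[m]_x (Num.min (u x) sigma ^+ 2) = \int[m]_x (B \o u) x.
  by apply: eq_Rintegral => x _; rewrite /B /= ger0_norm.
have := cheeger_L1 wl wb w0 wh; rewrite -[X in (X * _)%E](fineK hfin) -EFinM lee_fin.
move=> /le_trans; apply; apply: bint_le; first exact: bmeas_rslope.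
- apply: bmeasM; last exact: bmeas_rslope.
  apply: bmeasM; first exact: bmeasZ.
  apply: bmeas_indic; have := mu measurableT (`]-oo, sigma])%classic (measurable_itv _).
  by rewrite setTI; congr measurable; apply/seteqP; split => x /=; rewrite in_itv.
move=> x; rewrite indicE; case: (boolP (x \in _)) => xs /=.
  rewrite mulr1; apply: slope_comp => //; first by rewrite mulr_ge0.
  move=> e e0; exists e => // z ze.
  rewrite (le_trans (BM _ _))// ler_wpM2r// (ger0_norm (u0 x)).
  have : `|z| <= `|z - u x| + u x by rewrite -{2}(ger0_norm (u0 x)) (le_trans _ (ler_normD _ _))// subrK.
  lra.
rewrite mulr0; apply: slope_comp => // e e0.
have xs' : sigma < u x by rewrite ltNge; apply: contra xs => xs; exact: mem_set.
exists (u x - sigma); first by rewrite subr_gt0.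
move=> z; rewrite ltr_norml opprB ltrD2r => /andP[sz _].
have [z0 u0'] : 0 < z /\ 0 < u x by split; exact: lt_trans s0 _.
rewrite /B (gtr0_norm z0) (gtr0_norm u0') (min_idPr (ltW sz)) (min_idPr (ltW xs')) subrr normr0.
by rewrite add0r mulr_ge0// ltW.
Qed.

(** Integrate |Du|^2 >= 2 b |Du| - b^2 with b = (H/2) u + a u 1_{u <= sigma}.
    The choice b = (H/2) u alone is Cheeger's argument; the extra term gains
    a H sigma^2 m(u > sigma), because its truncation is still seen by Cheeger's
    inequality above the height sigma, where it no longer costs anything. *)
Lemma level_gap (u : X -> R) sigma a : half_supported u ->
  cheeger_constant m \is a fin_num -> 0 < sigma -> 0 <= a ->
  (H ^+ 2 / 4 - a ^+ 2) * \int[m]_x (u x ^+ 2) +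
  a * H * (sigma ^+ 2 * \int[m]_x \1_[set x | sigma < u x] x) <=
  \int[m]_x (rslope u x ^+ 2).
Proof.
move=> hu hfin s0 a0; case: (hu) => ul u0 uh.
have bu := lip_bmeas XD ul; case: (bu) => mu [M uM]; have bs := bmeas_rslope ul.
have H0 : 0 <= H by exact: fine_ge0 (cheeger_constant_ge0 m).
pose A : set (borel X) := [set x | u x <= sigma].
pose A' : set (borel X) := [set x | sigma < u x].
have mA' : measurable A' by apply: sub_sigma_algebra; exact: lip_open.
have AE : A = ~` A' by apply/seteqP; split => x; rewrite /A /A' /= leNgt => /negP.
have mA : measurable A by rewrite AE; exact: measurableC.
have bA := @bmeas_indic _ _ R _ mA; have bA' := @bmeas_indic _ _ R _ mA'.
have c1 : H * \int[m]_x (u x ^+ 2) <= \int[m]_x (2 * (u x * rslope u x)).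
  have M1 : 0 < M + 1 by rewrite ltr_wpDl// (le_trans _ (uM point)).
  have := cheeger_truncation hu hfin M1.
  have uM1 x : u x <= M + 1.
    by rewrite (le_trans (ler_norm _))// (le_trans (uM x))// lerDl.
  under eq_Rintegral do rewrite (min_idPl (uM1 _)).
  move=> /le_trans; apply; rewrite le_eqVlt; apply/orP; left; apply/eqP.
  apply: eq_Rintegral => x _; rewrite indicE mem_set; first by rewrite /= mulr1 mulrA.
  exact: uM1.
have c2 := cheeger_truncation hu hfin s0.
set Q := \int[m]_x (u x ^+ 2) in c1 *; set P := \int[m]_x (rslope u x ^+ 2).
set I1 := \int[m]_x (u x ^+ 2 * \1_A x); set I2 := \int[m]_x _.
have b1 : bmeas (fun x : borel X => u x ^+ 2 * \1_A x) by apply: bmeasM => //; exact: bmeasX.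
have minE : \int[m]_x (Num.min (u x) sigma ^+ 2) = I1 + sigma ^+ 2 * I2.
  rewrite -bintZ// -bintD//; last exact: bmeasZ.
  apply: eq_Rintegral => x _; rewrite !indicE.
  have [ux|ux] := leP (u x) sigma.
    by rewrite mem_set// memNset ?mulr1 ?mulr0 ?addr0//=; apply/negP; rewrite -leNgt.
  by rewrite memNset ?[_ \in A']mem_set ?mulr1 ?mulr0 ?add0r//=; apply/negP; rewrite -ltNge.
rewrite minE in c2.
have b2 : bmeas (fun x : borel X => 2 * (u x * rslope u x)) by apply/bmeasZ/bmeasM.
have b3 : bmeas (fun x : borel X => 2 * u x * \1_A x * rslope u x).
  by apply: bmeasM => //; apply: bmeasM => //; exact: bmeasZ.
have bu2 := bmeasX 2 bu.
have I1Q : I1 <= Q.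
  apply: bint_le => // x; rewrite indicE; case: (_ \in _); rewrite ?mulr1 ?mulr0//.
  exact: sqr_ge0.
have : H / 2 * \int[m]_x (2 * (u x * rslope u x)) + a * \int[m]_x (2 * u x * \1_A x * rslope u x)
    - (H ^+ 2 / 4 * Q + (H * a + a ^+ 2) * I1) <= P.
  rewrite -!bintZ// -!bintD//; [|exact: bmeasZ..].
  rewrite -bintB//; [|by apply: bmeasD; exact: bmeasZ..].
  apply: bint_le.
  - by apply: bmeasB; apply: bmeasD; exact: bmeasZ.
  - exact: bmeasX.
  move=> x; rewrite indicE; case: (_ \in _) => /=; rewrite ?mulr1 ?mulr0 ?mul0r.
    have := sqr_ge0 (rslope u x - (H / 2 * u x + a * u x)); lra.
  have := sqr_ge0 (rslope u x - H / 2 * u x); lra.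
have h1 := ler_wpM2l (_ : 0 <= H / 2) c1; have h2 := ler_wpM2l a0 c2.
have h3 : a ^+ 2 * I1 <= a ^+ 2 * Q by rewrite ler_wpM2l// sqr_ge0.
have {}h1 : H / 2 * (H * Q) <= H / 2 * \int[m]_x (2 * (u x * rslope u x)).
  by apply: h1; rewrite divr_ge0.
have E1 : H / 2 * (H * Q) = H ^+ 2 / 2 * Q by field.
have E2 : a * (H * (I1 + sigma ^+ 2 * I2)) = H * a * I1 + a * H * (sigma ^+ 2 * I2) by ring.
rewrite E1 in h1; rewrite E2 in h2; lra.
Qed.

(** Every value in (1, e^n] is, up to the factor e, one of the levels e^k
    below it. *)
Lemma exp_levels (x : R) (n : nat) :
  expR (- 2) * (x ^+ 2 * (1 < x <= expR n%:R)%R%:R) <=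
  \sum_(k < n) expR k%:R ^+ 2 * (expR k%:R < x)%R%:R.
Proof.
elim: n => [|n ih].
  rewrite big_ord0 expR0; have -> : (1 < x <= 1)%R = false by rewrite ltNge andNb.
  by rewrite !mulr0.
rewrite big_ord_recr /=; have [xn|nx] := leP x (expR n%:R).
  rewrite xn andbT in ih; rewrite /= mulr0 addr0 (le_trans _ ih)//.
  rewrite ler_wpM2l ?expR_ge0// ler_wpM2l ?sqr_ge0// ler_nat.
  by case: (1 < x) => //=; case: (_ <= _).
rewrite mulr1 (@le_trans _ _ (expR n%:R ^+ 2))//; last first.
  by rewrite lerDr sumr_ge0// => k _; rewrite mulr_ge0 ?sqr_ge0.
have [xn|_] := leP x (expR n.+1%:R); last by rewrite andbF !mulr0 sqr_ge0.
apply: (@le_trans _ _ (expR (- 2) * x ^+ 2)).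
  by rewrite ler_wpM2l ?expR_ge0// ler_piMr ?sqr_ge0// lern1 leq_b1.
have x0 : 0 <= x by rewrite (le_trans _ (ltW nx))// expR_ge0.
apply: (@le_trans _ _ (expR (- 2) * expR n.+1%:R ^+ 2)).
  by rewrite ler_wpM2l ?expR_ge0// lerXn2r ?nnegrE ?expR_ge0.
rewrite -!expRM_natl -expRD ler_expR -natr1; lra.
Qed.

(** Averaging level_gap over the n levels 1, e, ..., e^(n-1). *)
Lemma averaged_gap (u : X -> R) a (n : nat) : half_supported u ->
  cheeger_constant m \is a fin_num -> 0 <= a ->
  n%:R * ((H ^+ 2 / 4 - a ^+ 2) * \int[m]_x (u x ^+ 2)) +
  a * H * (expR (- 2) * \int[m]_x (u x ^+ 2 * \1_[set x | 1 < u x <= expR n%:R] x)) <=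
  n%:R * \int[m]_x (rslope u x ^+ 2).
Proof.
move=> hu hfin a0; case: (hu) => ul u0 uh; have bu := lip_bmeas XD ul.
have H0 : 0 <= H by exact: fine_ge0 (cheeger_constant_ge0 m).
pose A k : set (borel X) := [set x | expR k%:R < u x].
have mA k : measurable (A k) by apply: sub_sigma_algebra; exact: lip_open.
have bA k := @bmeas_indic _ _ R _ (mA k).
have lev : expR (- 2) * \int[m]_x (u x ^+ 2 * \1_[set x | 1 < u x <= expR n%:R] x) <=
    \sum_(k < n) expR k%:R ^+ 2 * \int[m]_x \1_(A k) x.
  have mI : measurable ([set x | 1 < u x <= expR n%:R] : set (borel X)).
    have := lip_measurable ul measurableT (measurable_itv `]1, (expR n%:R)]).
    by rewrite setTI; congr measurable; apply/seteqP; split => x /=; rewrite in_itv.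
  have bI : bmeas (fun x : borel X => u x ^+ 2 * \1_[set x | 1 < u x <= expR n%:R] x).
    by apply: bmeasM; [exact: bmeasX|exact: bmeas_indic].
  have -> : \sum_(k < n) expR k%:R ^+ 2 * \int[m]_x \1_(A k) x =
      \int[m]_x (\sum_(k < n) expR k%:R ^+ 2 * \1_(A k) x).
    rewrite (bint_sum m n (f := fun k x => expR k%:R ^+ 2 * \1_(A k) x)); last first.
      by move=> k; exact: bmeasZ.
    by apply: eq_bigr => k _; rewrite bintZ.
  rewrite -bintZ//; apply: bint_le; first exact: bmeasZ.
    by apply: (bmeas_sum n (f := fun k x => expR k%:R ^+ 2 * \1_(A k) x)) => k; exact: bmeasZ.
  move=> x; have := exp_levels (u x) n.
  rewrite indicE (_ : (x \in _) = (1 < u x <= expR n%:R)); last first.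
    by apply/idP/idP => [/set_mem//|h]; exact: mem_set.
  move=> /le_trans; apply; rewrite le_eqVlt; apply/orP; left; apply/eqP.
  apply: eq_bigr => k _; rewrite indicE; congr (_ * (nat_of_bool _)%:R).
  by apply/idP/idP => [h|/set_mem//]; exact: mem_set.
have aH : 0 <= a * H by rewrite mulr_ge0.
apply: (le_trans (lerD (lexx _) (ler_wpM2l aH lev))).
rewrite !mulr_natl -[n in X in X + _]card_ord -[n in X in _ <= X]card_ord.
rewrite -!sumr_const mulr_sumr -big_split/=; apply: ler_sum => k _.
by apply: level_gap => //; exact: expR_gt0.
Qed.

Lemma nat_between (x : R) : 1 <= x -> exists2 n : nat, 2 * x <= n%:R & n%:R <= 3 * x.
Proof.
move=> x1; have x0 : 0 <= 2 * x by lra.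
exists (Num.truncn (2 * x)).+1; first by rewrite ltW// truncnS_gt.
have : (Num.truncn (2 * x))%:R <= 2 * x by rewrite truncn_le.
rewrite -natr1; lra.
Qed.

(** Low entropy confines a quarter of the mass of u^2 to the values in
    (1, e^n], with n comparable to the entropy; then the average over n levels
    improves Cheeger's bound by H^2 / n^2, that is by H^2 / P up to a constant,
    as n^2 is at most P up to a constant by entropy_energy. When H^2 is
    smaller than P, the bound on P from below suffices. *)
Lemma normalized_gap (u : X -> R) : half_supported u ->
  cheeger_constant m \is a fin_num -> \int[m]_x (u x ^+ 2) = V ->
  (H ^+ 2 / 4 + gap_constant kappa D) * V <= \int[m]_x (rslope u x ^+ 2).
Proof.
move=> hu hfin uV; case: (hu) => ul u0 uh; have bu := lip_bmeas XD ul.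
have bu2 := bmeasX 2 bu.
have H0 : 0 <= H by exact: fine_ge0 (cheeger_constant_ge0 m).
have := entropy_energy D0 XD Xsep cd kappa0 Kkappa V0 ul u0 uh uV.
set e := _ / V => -[e0]; set s := expR _; set L := _ / V => eL.
have s0 : 0 < s by exact: expR_gt0.
have D20 : 0 < D ^+ 2 by exact: exprn_gt0.
have PE : \int[m]_x (rslope u x ^+ 2) = L * V by rewrite divfK// gt_eqF.
rewrite PE ler_pM2r//.
pose th : R := expR (- 2); have th0 : 0 < th by exact: expR_gt0.
have th1 : th <= 1 by rewrite expR_le1; lra.
have [n n2 n3] : exists2 n : nat, 2 * (e + 1) <= n%:R & n%:R <= 3 * (e + 1).
  by apply: nat_between; lra.
have n0 : 0 < n%:R :> R by lra.
pose I := \int[m]_x (u x ^+ 2 * \1_[set x | 1 < u x <= expR n%:R] x).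
have I4 : V / 4 <= I.
  pose Z : set (borel X) := [set x | 0 < u x].
  have mZ : measurable Z by apply: sub_sigma_algebra; exact: lip_open.
  have bZ := @bmeas_indic _ _ R _ mZ.
  have Zhalf : fine (m Z) <= V / 2.
    by rewrite -lee_fin fineK ?fin_num_measure// mulrC EFinM fineK ?fin_num_measure.
  have mI : measurable ([set x | 1 < u x <= expR n%:R] : set (borel X)).
    have := lip_measurable ul measurableT (measurable_itv `]1, (expR n%:R)]).
    by rewrite setTI; congr measurable; apply/seteqP; split => x /=; rewrite in_itv.
  have bI : bmeas (fun x : borel X => u x ^+ 2 * \1_[set x | 1 < u x <= expR n%:R] x).
    by apply: bmeasM => //; exact: bmeas_indic.
  have bx := bmeas_xlnx bu2 (fun x => sqr_ge0 (u x)).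
  have b1 : bmeas (fun x : borel X => 1 : R) by exact: bmeas_cst.
  have : V <= I + (fine (m Z) + (2 * n%:R)^-1 * (e * V + 1 * V)).
    have eV : \int[m]_x (u x ^+ 2 * ln (u x ^+ 2)) = e * V by rewrite divfK// gt_eqF.
    rewrite -{1}uV -eV -(bint_cst m 1) -bintD// -bintZ; last exact: bmeasD.
    rewrite -(bint_indic m mZ) -bintD//; last by apply: bmeasZ; exact: bmeasD.
    rewrite -bintD//; last by apply: bmeasD => //; apply: bmeasZ; exact: bmeasD.
    apply: bint_le => //.
      by apply: bmeasD => //; apply: bmeasD => //; apply: bmeasZ; exact: bmeasD.
    move=> x; have y0 := sqr_ge0 (u x); have xl := xlnx_ge y0.
    have t0 : 0 <= (2 * n%:R)^-1 * (u x ^+ 2 * ln (u x ^+ 2) + 1).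
      by rewrite mulr_ge0 ?invr_ge0 ?mulr_ge0 ?(ltW n0)//; lra.
    rewrite !indicE (_ : (x \in Z) = (0 < u x)); last first.
      by apply/idP/idP => [/set_mem//|h]; exact: mem_set.
    rewrite (_ : (x \in _) = (1 < u x <= expR n%:R)); last first.
      by apply/idP/idP => [/set_mem//|h]; exact: mem_set.
    have [u1|u1] := leP (u x) 1.
      rewrite mulr0 add0r; have [ux|] := ltP 0 (u x).
        have : u x ^+ 2 <= 1 by rewrite expr_le1.
        rewrite /=; lra.
      move=> ux; have u00 : u x = 0 by apply/eqP; rewrite eq_le ux u0.
      by move: t0; rewrite u00 expr0n /= add0r.
      rewrite (lt_trans ltr01 u1) /=; have [un|nu] := leP (u x) (expR n%:R).
      rewrite mulr1; lra.
    rewrite mulr0 add0r (@le_trans _ _ ((2 * n%:R)^-1 * (u x ^+ 2 * ln (u x ^+ 2) + 1)))//; last by rewrite lerDr.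
    rewrite ler_pdivlMl ?mulr_gt0// (@le_trans _ _ (u x ^+ 2 * ln (u x ^+ 2)))//; last by rewrite lerDl.
    rewrite mulrC ler_wpM2l// lnXn ?(lt_trans ltr01)//.
    have : n%:R <= ln (u x).
      by rewrite -[leLHS]expRK ler_ln ?posrE ?expR_gt0 ?(lt_trans ltr01)// ltW.
    lra.
  have : (2 * n%:R)^-1 * (e * V + 1 * V) <= V / 4.
    rewrite ler_pdivrMl ?mulr_gt0//; have := ler_wpM2r (ltW V0) n2; lra.
  lra.
(* the maximiser of a H th / (4 n) - a^2 *)
pose a := H * th / (8 * n%:R).
have a0 : 0 <= a by apply: divr_ge0; apply: mulr_ge0 => //; exact: ltW.
have := averaged_gap n hu hfin a0; rewrite uV PE -/th -/I => avg.
have : a * H * (th * (V / 4)) <= a * H * (th * I).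
  apply: ler_wpM2l; first exact: mulr_ge0.
  by apply: ler_wpM2l => //; exact: ltW.
move=> hI; have {}avg : n%:R * ((H ^+ 2 / 4 - a ^+ 2) * V) + a * H * (th * (V / 4)) <= n%:R * (L * V).
  lra.
have {}avg : H ^+ 2 / 4 + H ^+ 2 * th ^+ 2 / (64 * n%:R ^+ 2) <= L.
  rewrite -(ler_pM2l (mulr_gt0 n0 V0)).
  have -> : n%:R * V * L = n%:R * (L * V) by ring.
  apply: le_trans avg; rewrite le_eqVlt; apply/orP; left; apply/eqP.
  by rewrite /a; field; rewrite gt_eqF.
have L_ge : s / (16 * D ^+ 2) <= L.
  have e1 : 1 <= (e + 1) ^+ 2 by apply: exprn_ege1; lra.
  rewrite ler_pdivrMr ?mulr_gt0//; have := ler_wpM2l (ltW s0) e1; lra.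
have L0 : 0 < L by rewrite (lt_le_trans _ L_ge)// divr_gt0// mulr_gt0.
have gapE : gap_constant kappa D = th ^+ 2 / 288 * (s / (16 * D ^+ 2)) by [].
have th2 : th ^+ 2 <= 1 by rewrite expr_le1// ltW.
have [HL|HL] := leP (2 * L) (H ^+ 2).
  apply: le_trans avg; rewrite lerD2l gapE.
  set w := s / _; have n2w : w * n%:R ^+ 2 <= 9 * L.
    have : n%:R ^+ 2 <= (3 * (e + 1)) ^+ 2 by apply: lerXn2r => //; rewrite nnegrE; lra.
    rewrite exprMn => /(ler_wpM2l (ltW s0)) h.
    by rewrite /w mulrAC ler_pdivrMr ?mulr_gt0//; lra.
  have -> : H ^+ 2 * th ^+ 2 / (64 * n%:R ^+ 2) = th ^+ 2 * (H ^+ 2 / (64 * n%:R ^+ 2)) by ring.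
  have -> : th ^+ 2 / 288 * w = th ^+ 2 * (w / 288) by ring.
  apply: ler_wpM2l; first exact: sqr_ge0.
  have p64 : 0 < 64 * n%:R ^+ 2 :> R by rewrite mulr_gt0// exprn_gt0.
  rewrite ler_pdivlMr//; lra.
have thL : th ^+ 2 * (s / (16 * D ^+ 2)) <= 1 * L.
  by apply: ler_pM => //; [exact: sqr_ge0|rewrite divr_ge0 ?mulr_ge0// ltW].
rewrite gapE; lra.
Qed.

(** Both sides are 2-homogeneous in u, so normalized_gap applies to a multiple
    of u. *)
Lemma half_supported_gap (u : X -> R) : half_supported u ->
  cheeger_constant m \is a fin_num ->
  (H ^+ 2 / 4 + gap_constant kappa D) * \int[m]_x (u x ^+ 2) <= \int[m]_x (rslope u x ^+ 2).
Proof.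
move=> hu hfin; case: (hu) => ul u0 uh; have bu := lip_bmeas XD ul.
set Q := \int[m]_x (u x ^+ 2); have Q0 : 0 <= Q by apply: Rintegral_ge0 => x _; exact: sqr_ge0.
have [->|Qn0] := eqVneq Q 0; first by rewrite mulr0; apply: Rintegral_ge0 => x _; exact: sqr_ge0.
have {Qn0}Q0 : 0 < Q by rewrite lt0r Qn0.
pose c := Num.sqrt (V / Q); have c0 : 0 < c by rewrite sqrtr_gt0 divr_gt0.
have c2 : c ^+ 2 = V / Q by rewrite sqr_sqrtr// ltW// divr_gt0.
pose v (x : X) := c * u x.
have vl : lip v.
  case: ul => L L0 uL; exists (c * L); first by rewrite mulr_ge0// ltW.
  by move=> x y; rewrite -mulrBr normrM gtr0_norm// -mulrA ler_pM2l.
have hv : half_supported v.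
  split => //; first by move=> x; rewrite mulr_ge0// ltW.
  rewrite (_ : [set x | _] = [set x | (0 < u x)%R])//.
  by apply/seteqP; split => x /=; rewrite pmulr_rgt0.
have vV : \int[m]_x (v x ^+ 2) = V.
  under eq_Rintegral do rewrite exprMn.
  by rewrite bintZ ?c2 ?divfK ?gt_eqF//; exact: bmeasX.
have slv x : rslope v x <= c * rslope u x.
  apply: (@slope_comp _ _ (fun t => c * t)) => //; first exact: ltW.
  move=> e e0; exists 1 => // t _; rewrite -mulrBr normrM gtr0_norm//.
  by rewrite ler_wpM2r// lerDl ltW.
have := normalized_gap hv hfin vV; set lam := _ + _; move: lam => lam.
have bs := bmeas_rslope ul; have bs2 := bmeasX 2 bs.
have : \int[m]_x (rslope v x ^+ 2) <= c ^+ 2 * \int[m]_x (rslope u x ^+ 2).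
  rewrite -bintZ//; apply: bint_le; [exact/bmeasX/bmeas_rslope|exact: bmeasZ|].
  by move=> x; rewrite -exprMn lerXn2r// nnegrE ?mulr_ge0 ?rslope_ge0// ltW.
move=> h1 h2; have := le_trans h2 h1; rewrite c2.
have -> : V / Q * \int[m]_x (rslope u x ^+ 2) = \int[m]_x (rslope u x ^+ 2) / Q * V by ring.
by rewrite (ler_pM2r V0) (ler_pdivlMr _ _ Q0).
Qed.

End Gap.

(** * From the mean to the median *)

Definition excess {T : Type} {R : realType} (f : T -> R) (b : R) (x : T) : R :=
  Num.max 0 (f x - b).

Section Excess.
Context {R : realType} {X : completeMetricType R}.
Implicit Types f : X -> R.

Lemma max0_lip (b z z' : R) :
  `|Num.max 0 (z - b) - Num.max 0 (z' - b)| <= `|z - z'|.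
Proof.
wlog zz : z z' / z' <= z.
  move=> W; case: (leP z' z) => [/W//|/ltW/W].
  by rewrite distrC (distrC z).
have h : Num.max 0 (z' - b) <= Num.max 0 (z - b).
  by rewrite ge_max !le_max lexx lerD2r zz orbT.
rewrite !ger0_norm ?subr_ge0//; rewrite /Num.max; do 2 case: ifP; lra.
Qed.

Lemma excess_lip f b : lip f -> lip (excess f b).
Proof.
move=> [L L0 fL]; exists L => // x y.
exact: le_trans (max0_lip _ _ _) (fL x y).
Qed.

Lemma rslope_excess f b x : lip f -> rslope (excess f b) x <= rslope f x * (b <= f x)%R%:R.
Proof.
move=> fl; have el := excess_lip b fl; have [bf|fb] := leP b (f x).
  rewrite mulr1 -[leRHS]mul1r.
  apply: (@slope_comp _ _ (fun t => Num.max 0 (t - b))) => // e e0.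
  exists 1 => // t _; rewrite (le_trans (max0_lip _ _ _))//.
  by rewrite ler_peMl// lerDl ltW.
rewrite mulr0 -[leRHS](mul0r (rslope f x)).
apply: (@slope_comp _ _ (fun t => Num.max 0 (t - b))) => // e e0.
exists (b - f x); first by rewrite subr_gt0.
move=> t; rewrite ltr_norml ltrD2r => /andP[_ tb].
rewrite (max_idPl (_ : t - b <= 0)) ?subr_le0 ?(ltW tb)//.
rewrite (max_idPl (_ : f x - b <= 0)) ?subr_le0 ?(ltW fb)//.
by rewrite subrr normr0 add0r mulr_ge0// ltW.
Qed.

Lemma lipN f : lip f -> lip (fun x => - f x).
Proof.
by move=> [L L0 fL]; exists L => // x y; rewrite -opprD normrN.
Qed.

Lemma rslopeN f x : lip f -> rslope (fun x => - f x) x <= rslope f x.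
Proof.
move=> fl; rewrite -[leRHS]mul1r.
apply: (@slope_comp _ _ (fun t => - t)) => //; first exact: lipN.
move=> e e0; exists 1 => // t _; rewrite -opprD normrN.
by rewrite ler_peMl// lerDl ltW.
Qed.

(** At every point one of the two excesses vanishes in a neighbourhood. The
    strict separation b' < b is essential: on a level set of positive measure
    both excesses over the same level could inherit the slope of f. *)
Lemma rslope_excess_split f b b' x : lip f -> b' < b ->
  rslope (excess f b) x ^+ 2 + rslope (excess (fun x => - f x) (- b')) x ^+ 2 <= rslope f x ^+ 2.
Proof.
move=> fl bb; have h1 := rslope_excess b x fl.
have h2 := rslope_excess (- b') x (lipN fl); have h3 := rslopeN x fl.
have s0 := rslope_ge0 f x; have e1 := rslope_ge0 (excess f b) x.
have e2 := rslope_ge0 (excess (fun x => - f x) (- b')) x.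
have e3 := rslope_ge0 (fun x => - f x) x.
rewrite lerN2 in h2; have [bf|fb] := leP b (f x); rewrite ?bf in h1.
  have fb' : (f x <= b') = false by rewrite leNgt (lt_le_trans bb bf).
  rewrite fb' mulr0 in h2.
  have -> : rslope (excess (fun x => - f x) (- b')) x = 0 by apply/eqP; rewrite eq_le h2.
  rewrite mulr1 in h1.
  by rewrite expr0n addr0 lerXn2r.
rewrite (leNgt b) fb mulr0 in h1.
have -> : rslope (excess f b) x = 0 by apply/eqP; rewrite eq_le h1.
rewrite expr0n add0r; apply: lerXn2r => //; apply: le_trans h2 _.
by case: (f x <= b'); rewrite /= ?mulr1 ?mulr0.
Qed.

End Excess.

Section Median.
Context {R : realType} {X : completeMetricType R}.
Variables (m : {finite_measure set (borel X) -> \bar R}).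
Local Notation V := (fine (m setT)).
Hypothesis V0 : 0 < V.

Lemma half_supportedP (u : X -> R) : lip u -> (forall x, 0 <= u x) ->
  fine (m [set x | 0 < u x]) <= V / 2 -> half_supported m u.
Proof.
move=> ul u0 uh; split => //.
rewrite -[leLHS]fineK ?fin_num_measure//; last first.
  by apply: sub_sigma_algebra; exact: lip_open.
by rewrite -[m setT]fineK ?fin_num_measure// -EFinM lee_fin mulrC.
Qed.

(** Any c = sup {t | m(f < t) <= m(X)/2} is a median; the margin d spares the
    discussion of atoms of f at the level c. *)
Lemma median_exists (f : X -> R) : lip f -> (exists M, forall x, `|f x| <= M) ->
  exists c, forall d, 0 < d -> half_supported m (excess f (c + d)) /\
    half_supported m (excess (fun x => - f x) (- (c - d))).
Proof.
move=> fl [M fM]; pose F t : set (borel X) := [set x | f x < t].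
have mF t : measurable (F t).
  apply: sub_sigma_algebra; rewrite (_ : F t = [set x | - t < - f x]).
    exact: lip_open (lipN fl).
  by apply/seteqP; split => x; rewrite /F /= ltrN2.
have mle (A B : set (borel X)) : measurable A -> measurable B -> A `<=` B ->
    fine (m A) <= fine (m B).
  move=> mA mB AB; apply: fine_le; rewrite ?fin_num_measure//.
  by apply: le_measure; rewrite ?inE.
pose S := [set t | fine (m (F t)) <= V / 2].
have S0 : S (- M).
  rewrite /S /= (_ : F (- M) = set0) ?measure0/= ?divr_ge0 ?(ltW V0)//.
  apply/seteqP; split => x //; rewrite /F /=; have := fM x.
  by rewrite ler_norml leNgt => /andP[/negP].
have Sub : ubound S (M + 1).
  move=> t; rewrite /S /= leNgt => h; rewrite leNgt; apply: contra h => Mt.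
  rewrite (_ : F t = setT).
    by rewrite ltr_pdivrMr// ltr_pMr ?ltr1n//; exact: V0.
  apply/seteqP; split => x // _; rewrite /F /=; have := fM x.
  rewrite ler_norml => /andP[_ /le_lt_trans]; apply.
  by rewrite (lt_trans _ Mt)// ltrDl.
have hS : has_sup S by split; [exists (- M)|exists (M + 1)].
exists (sup S) => d d0; split; apply: half_supportedP.
- exact: excess_lip.
- by move=> x; rewrite le_max lexx.
- have : ~ S (sup S + d).
    by move=> /(ub_le_sup hS.2); rewrite gerDl leNgt d0.
  rewrite /S /= => /negP; rewrite -ltNge => h.
  have -> : [set x | 0 < excess f (sup S + d) x] = [set x | sup S + d < f x].
    by apply/seteqP; split => x; rewrite /excess /= lt_max ltxx /= subr_gt0.
  pose G : set (borel X) := [set x | sup S + d < f x].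
  have mG : measurable G by apply: sub_sigma_algebra; exact: lip_open.
  have FG : G `<=` ~` F (sup S + d).
    by move=> x; rewrite /G /F /= => /ltW; rewrite leNgt => /negP.
  have := mle _ _ mG (measurableC (mF _)) FG.
  rewrite -/G => /le_trans; apply.
  have := measureU m (mF (sup S + d)) (measurableC (mF (sup S + d))) (setICr _).
  rewrite setUv => /(congr1 fine); rewrite fineD ?fin_num_measure//; last exact: measurableC.
  lra.
- exact/excess_lip/lipN.
- by move=> x; rewrite le_max lexx.
- have [t St dt] := sup_adherent d0 hS.
  have -> : [set x | 0 < excess (fun x => - f x) (- (sup S - d)) x] = F (sup S - d).
    by apply/seteqP; split => x; rewrite /excess /F /= lt_max ltxx /= subr_gt0 ltrN2.
  apply: le_trans (mle _ _ (mF _) (mF t) _) St.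
  by move=> x; rewrite /F /= => /lt_trans; apply.
Qed.

End Median.

Section MeanZero.
Context {R : realType} {X : completeMetricType R}.
Variable D : R.
Hypothesis D0 : 0 < D.
Hypothesis XD : forall x y : X, mdist x y <= D.
Hypothesis Xsep : exists2 S : set X, countable S & dense S.
Variables (m : {finite_measure set (borel X) -> \bar R}) (K kappa : R).
Hypothesis cd : CD_infty m K.
Hypotheses (kappa0 : 0 <= kappa) (Kkappa : - K <= kappa).
Local Notation V := (fine (m setT)).
Hypothesis V0 : 0 < V.
Local Notation H := (fine (cheeger_constant m)).

(** The mean minimises the L2 distance to the constants, so replacing it by a
    median only increases the denominator, while the energy splits over the
    two excesses. *)
Lemma mean_zero_gap (f : X -> R) : lip f -> \int[m]_x f x = 0 ->
  0 < \int[m]_x (f x ^+ 2) ->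
  cheeger_constant m \is a fin_num /\
  (H ^+ 2 / 4 + gap_constant kappa D) * \int[m]_x (f x ^+ 2) <=
  \int[m]_x (rslope f x ^+ 2).
Proof.
move=> fl f0 Q0; have bf := lip_bmeas XD fl; case: (bf) => _ fb.
have [c hc] := median_exists V0 fl fb.
set Q := \int[m]_x _ in Q0 *.
pose up d := excess f (c + d).
pose um d := excess (fun x => - f x) (- (c - d)).
have bc a : bmeas (fun x : borel X => a : R) by exact: bmeas_cst.
have bfc : bmeas (fun x : borel X => f x - c) by exact: bmeasB.
have bN : bmeas (fun x : borel X => `|f x - c|).
  case: bfc => mfc [M fM]; split; first exact: measurableT_comp.
  by exists M => x; rewrite normr_id.
pose N := \int[m]_x `|f x - c|.
have N0 : 0 <= N by exact: Rintegral_ge0.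
(* cutting off a band of half-width d around the median loses little of the L2 norm *)
have mass d : 0 < d -> Q - 2 * d * N <= \int[m]_x (up d x ^+ 2) + \int[m]_x (um d x ^+ 2).
  move=> d0; have [[ul _ _] [ul' _ _]] := hc d d0.
  have b1 := bmeasX 2 (lip_bmeas XD ul); have b2 := bmeasX 2 (lip_bmeas XD ul').
  have -> : Q = \int[m]_x (f x ^+ 2 - 2 * c * f x).
    by rewrite bintB ?bintZ ?f0 ?mulr0 ?subr0//; [exact: bmeasX|exact: bmeasZ].
  have bq : bmeas (fun x : borel X => f x ^+ 2 - 2 * c * f x).
    by apply: bmeasB; [exact: bmeasX|exact: bmeasZ].
  rewrite -bintZ// -bintB//; last exact: bmeasZ.
  rewrite -bintD//; apply: bint_le; [by apply: bmeasB => //; exact: bmeasZ|exact: bmeasD|].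
  move=> x; rewrite /up /um /excess; have cc := sqr_ge0 c.
  have -> : - f x - - (c - d) = c - d - f x by ring.
  have [fc|cf] := leP c (f x).
    rewrite (@max_l _ _ 0 (c - d - f x)); last by lra.
    rewrite ger0_norm ?subr_ge0//.
    have [h|h] := leP 0 (f x - (c + d)); nra.
  rewrite (@max_l _ _ 0 (f x - (c + d))); last by lra.
  rewrite ltr0_norm ?subr_lt0//.
  have [h|h] := leP 0 (c - d - f x); nra.
have hfin : cheeger_constant m \is a fin_num.
  pose d := Q / (4 * (N + 1)).
  have N1 : 0 < N + 1 by rewrite ltr_wpDl.
  have d0 : 0 < d by rewrite divr_gt0// mulr_gt0.
  have [hp hm] := hc d d0.
  have : 0 < Q - 2 * d * N.
    have E : d * (4 * (N + 1)) = Q by rewrite divfK// gt_eqF// mulr_gt0.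
    nra.
  move=> /lt_le_trans/(_ (mass d d0)) pos.
  have [p0|p0] := ltP 0 (\int[m]_x (up d x ^+ 2)); first exact: cheeger_fin_num hp p0.
  apply: (cheeger_fin_num XD hm); rewrite (lt_le_trans pos)//.
  by rewrite gerDr.
split => //; have H0 : 0 <= H by exact: fine_ge0 (cheeger_constant_ge0 m).
have lam0 : 0 <= H ^+ 2 / 4 + gap_constant kappa D.
  by rewrite addr_ge0 ?(ltW (gap_constant_gt0 _ D0))// divr_ge0 ?sqr_ge0.
have gap u := @half_supported_gap _ _ _ D0 XD Xsep _ _ _ cd kappa0 Kkappa V0 u ^~ hfin.
move: (_ + _) lam0 gap => lam lam0 gap.
have bound d : 0 < d -> lam * (Q - 2 * d * N) <= \int[m]_x (rslope f x ^+ 2).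
  move=> d0; have [hp hm] := hc d d0; have [ul _ _] := hp; have [ul' _ _] := hm.
  apply: le_trans (ler_wpM2l lam0 (mass d d0)) _; rewrite mulrDr.
  apply: (le_trans (lerD (gap _ hp) (gap _ hm))).
  have b1 := bmeasX 2 (bmeas_rslope ul); have b2 := bmeasX 2 (bmeas_rslope ul').
  rewrite -bintD//; apply: bint_le; [exact: bmeasD|exact/bmeasX/bmeas_rslope|].
  by move=> x; apply: rslope_excess_split => //; lra.
apply/ler_addgt0Pr => e e0.
pose M := lam * (2 * N) + 1; have M0 : 0 < M by rewrite ltr_wpDl// !mulr_ge0.
have := bound (e / M) (divr_gt0 e0 M0).
have E : e / M * M = e by rewrite divfK// gt_eqF.
have : 0 < e / M by exact: divr_gt0.
move: (e / M) E => d E d0; move: E; rewrite /M; nra.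
Qed.

End MeanZero.

Lemma finite_measure_of {d} {T : measurableType d} {R : realType}
  (m : {measure set T -> \bar R}) : (m setT < +oo)%E ->
  exists mf : {finite_measure set T -> \bar R}, m = mf.
Proof.
move=> mfin; exists (mfrestr measurableT mfin); apply: eq_measure.
by apply/funext => A; rewrite /= /mfrestr /mrestr setIT.
Qed.

Theorem corollary1p5 (R : realType) (K N D : R) (hN : 1 <= N) (hD : 0 < D) :
  exists2 eps : R, 0 < eps &
    forall (X : completeMetricType R) (m : {measure set (borel X) -> \bar R}),
      RCD m K N -> (diameter X <= D%:E)%E ->
      ((4^-1)%:E * cheeger_constant m ^+ 2 + eps%:E <= lambda1 m)%E.
Proof.
pose kappa := `|K|; have kappa0 : 0 <= kappa by exact: normr_ge0.
have Kkappa : - K <= kappa by rewrite /kappa -normrN ler_norm.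
exists (gap_constant kappa D); first exact: gap_constant_gt0.
move=> X m [[[Xsep _ Xsupp [x0 [M [c [M0 c0 mball]]]]] cd _] _] diamD.
have XD (x y : X) : mdist x y <= D.
  rewrite -lee_fin; apply: le_trans diamD.
  by apply: ereal_sup_ubound; exists (x, y).
have mfin : (m setT < +oo)%E.
  have D1 : 0 <= D + 1 by rewrite addr_ge0// ltW.
  apply: le_lt_trans (ltry (M * expR (c * (D + 1) ^+ 2))).
  apply: le_trans (mball _ D1); rewrite (_ : ball x0 (D + 1) = setT)//.
  apply/seteqP; split => // x _; rewrite ballEmdist /=.
  by rewrite (le_lt_trans (XD _ _))// ltrDl.
have [mf mE] := finite_measure_of mfin.
move: Xsupp cd; rewrite {}mE => Xsupp cd {mball mfin}.
have mpos (U : set X) x : open U -> U x -> (0 < mf U)%E.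
  move=> oU Ux; have : msupport mf x by rewrite Xsupp.
  by apply; split.
have V0 : 0 < fine (mf setT).
  apply: fine_gt0; rewrite (mpos setT x0)//=; last exact: openT.
  exact: fin_num_fun_lty (fin_num_measure mf).
apply: le_ereal_inf_tmp => _ [f [/= [/lipP fl _] [x fx0] f0] <-].
have bf := lip_bmeas XD fl.
have bf2 := bmeasX 2 bf; have bs2 := bmeasX 2 (bmeas_rslope fl).
have f0' : \int[mf]_x f x = 0 by apply: EFin_inj; rewrite -bintE.
have Q0 : 0 < \int[mf]_x (f x ^+ 2).
  pose a := `|f x| / 2; have a0 : 0 < a by rewrite divr_gt0// normr_gt0.
  pose U : set (borel X) := [set y | a < `|f y|].
  have oU : open U.
    have fnl : lip (fun y => `|f y|).
      case: fl => L L0 fL; exists L => // y z.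
      by rewrite (le_trans _ (fL y z))// ler_dist_dist.
    exact: lip_open fnl.
  have mU : measurable U by exact: sub_sigma_algebra.
  have Ux : U x by rewrite /U /= ltr_pdivrMr// ltr_pMr ?ltr1n ?normr_gt0.
  have mUp : 0 < fine (mf U).
    apply: fine_gt0; rewrite (mpos U x)//=.
    by rewrite ltey_eq fin_num_measure.
  apply: (@lt_le_trans _ _ (a ^+ 2 * fine (mf U))); first by rewrite mulr_gt0// exprn_gt0.
  rewrite -bint_indic// -bintZ; last exact: bmeas_indic.
  apply: bint_le => //; first exact/bmeasZ/bmeas_indic.
  move=> y; rewrite indicE; case: (boolP (y \in U)) => [/set_mem Uy|_] /=.
    rewrite mulr1 -[leRHS]real_normK ?num_real//.
    by rewrite lerXn2r// ?nnegrE ?(ltW a0)// ltW.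
  by rewrite mulr0 sqr_ge0.
have [hfin gap] := mean_zero_gap hD XD Xsep cd kappa0 Kkappa V0 fl f0' Q0.
have -> : (\int[mf]_x (slope f x ^+ 2) = (\int[mf]_x (rslope f x ^+ 2))%:E)%E.
  by rewrite -bintE//; apply: eq_integral => y _; rewrite rslopeE.
rewrite (bintE _ bf2) inver gt_eqF// -EFinM.
rewrite -[cheeger_constant mf]fineK// -!EFinM -EFinD lee_fin -expr2.
by rewrite ler_pdivlMr// [4^-1 * _]mulrC.
Qed.
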